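(* Let $\mu\in\mathbb{R}$ and $\sigma>0$. For each $n\ge 2$ let $X=(X_1,\dots,X_n)$ be a vector of i.i.d. $N(\mu,\sigma^2)$ random variables, let $\Pi$ be a uniformly random permutation of $\{1,\dots,n\}$ independent of $X$, let $$T(X,\Pi)=\frac{1}{d_2}\cdot\frac{1}{n-1}\sum_{t=2}^{n}\bigl|X_{\Pi(t)}-X_{\Pi(t-1)}\bigr|,\qquad d_2=\frac{2}{\sqrt{\pi}},$$ and let $$\mathrm{AdjFrac}(n)=\frac{\mathbb{E}\bigl[\mathrm{Var}\{T(X,\Pi)\mid X\}\bigr]}{\mathrm{Var}\{T(X,\Pi)\}}.$$ Then $$\lim_{n\to\infty}\mathrm{AdjFrac}(n)=\frac{\pi+3-3\sqrt{3}}{2\pi+3\sqrt{3}-9}\approx 0.3813.$$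
   Context: $\mathrm{Var}\{T(X,\Pi)\mid X\}$ is the conditional variance given $X$, i.e. the variance over the uniformly random permutation $\Pi$ with the values $X$ held fixed. The symbol $\pi$ in the displayed formulas is the circle constant. *)

(* Defs.v *)
From HB Require Import structures.
From mathcomp Require Import all_boot all_order all_algebra perm.
From mathcomp Require Import all_classical all_reals all_analysis.

Set Implicit Arguments.
Unset Strict Implicit.
Unset Printing Implicit Defensive.

Import Order.TTheory GRing.Theory Num.Theory.
Import numFieldNormedType.Exports.

Local Open Scope classical_set_scope.
Local Open Scope ring_scope.

Section Statistic.
Context {R : realType}.

Definition d2 : R := 2 / Num.sqrt pi.

(* Positions are numbered from 0, so t ranges over 1, ..., n - 1, and
   ord_pred t is the position t - 1 (there is no wrap-around since 0 < t). *)
Definition Tstat (n : nat) (x : n.-tuple R) (s : 'S_n) : R :=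
  d2^-1 * (n.-1%:R^-1 *
    \sum_(t < n | (0 < t)%N) `|tnth x (s t) - tnth x (s (ord_pred t))|).

End Statistic.

Section RandomVectors.
Context {d : measure_display} {Omega : measurableType d} {R : realType}.
Variables (P : probability Omega R) (n : nat).
Variables (X : 'I_n -> {RV P >-> R}) (Pi : Omega -> 'S_n).

Definition sample (w : Omega) : n.-tuple R := [tuple X i w | i < n].

Definition mutually_independent : Prop :=
  forall (J : {set 'I_n}) (B : 'I_n -> set R),
    (forall i, measurable (B i)) ->
    P [set w | forall i, i \in J -> B i (X i w)] =
    (\prod_(i in J) P (X i @^-1` B i))%E.

(* N(mu, sigma^2): normal_prob takes the standard deviation. The laws are
   compared on measurable sets only, outside of which distribution and
   normal_prob have arbitrary values. *)
Definition iid_normal (mu sigma : R) : Prop :=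
  (forall i (B : set R), measurable B ->
     distribution P (X i) B = normal_prob mu sigma B) /\
  mutually_independent.

Definition uniform_permutation : Prop :=
  forall s : 'S_n,
    measurable (Pi @^-1` [set s]) /\
    P (Pi @^-1` [set s]) = ((n`!)%:R^-1)%:E.

(* 'S_n carries its discrete sigma-algebra, so A is arbitrary. *)
Definition permutation_independent : Prop :=
  forall (B : set (n.-tuple R)) (A : set 'S_n),
    measurable B ->
    P ((sample @^-1` B) `&` (Pi @^-1` A)) =
    (P (sample @^-1` B) * P (Pi @^-1` A))%E.

(* Var{T(X, Pi) | X = x}: the variance over the random permutation alone, with
   the data held fixed at x. *)
Definition cond_var (x : n.-tuple R) : R :=
  fine 'V_P[fun w => Tstat x (Pi w)].

Definition AdjFrac : R :=
  fine 'E_P[fun w => cond_var (sample w)] /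
  fine 'V_P[fun w => Tstat (sample w) (Pi w)].

End RandomVectors.

(* Main.v *)
Require Import Defs.
From HB Require Import structures.
From mathcomp Require Import all_boot all_order all_algebra perm.
From mathcomp Require Import all_classical all_reals all_analysis.
From mathcomp Require Import measurable_realfun ring lra zify.

Set Implicit Arguments.
Unset Strict Implicit.
Unset Printing Implicit Defensive.

Import Order.TTheory GRing.Theory Num.Theory.
Import numFieldNormedType.Exports.

Local Open Scope classical_set_scope.
Local Open Scope ring_scope.

(** Given the permutation, T is up to the factor 1/d2 the average distance between
    consecutive entries of an i.i.d. normal vector, and the mean of T does not
    depend on the permutation; so Var T only involves the variance v0 of
    a distance |X1 - X2| and the covariance v1 of two distances sharing an entry.
    Averaging T over the permutations gives a multiple G of the mean of all
    pairwise distances, and E[Var(T | X)] = E[T^2] - E[G^2] is again a combination of v0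
    and v1.  The quotient is a rational function of 1/n with value
    (v0 - 2 v1) / (v0 + 2 v1) at 0.  Finally v1 is computed by conditioning on the
    shared entry y: it is the variance of h(Y), where h(y) = E|X - y|. *)

(** * Integrals against a normal law *)

(** Every one-dimensional moment comes from an explicit antiderivative built from the density [phi],
    its distribution function [Phi] and a normal distribution function of smaller variance, so only
    limits at both infinities remain to be evaluated. The [sqrt 3] of the answer has its origin
    here: integrating [h ^ 2 * phi] by parts leaves a multiple of [phi ^ 3], which is proportional
    to a normal density of variance [s ^ 2 / 3]. The limit itself is a comparison of leading terms.
    With [c = 1 / d2], [Var T] is about [c ^ 2 * (v0 + 2 * v1) / n], because a path has about as
    many adjacent pairs of edges as edges, while [Var G] is about [4 * c ^ 2 * v1 / n]. [T] and [G]
    have the same mean, so the squared means cancel in [E[T ^ 2] - E[G ^ 2]]; the factors [c ^ 2]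
    and [sigma ^ 2] cancel in the quotient. *)

Section normal.
Context {R : realType} (m s : R).
Hypothesis s_gt0 : 0 < s.
Local Notation mu := (@lebesgue_measure R).
Local Notation phi := (normal_pdf m s).

Let s_neq0 : s != 0. Proof. by rewrite gt_eqF. Qed.

(** Change of variables yields the Radon-Nikodym derivative, which is determined only almost
    everywhere; it agrees almost everywhere with [phi] because both integrate to [normal_prob] over
    every measurable set. *)
Lemma ge0_integral_normal_prob (f : R -> \bar R) :
  measurable_fun [set: R] f -> (forall x, (0 <= f x)%E) ->
  (\int[normal_prob m s]_x f x = \int[mu]_x (f x * (phi x)%:E))%E.
Proof.
move=> mf f0.
have dom : normal_prob m s `<< mu by exact: normal_prob_dominates.
rewrite -(Radon_Nikodym_SigmaFinite.change_of_variables dom)//.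
have iphi : mu.-integrable setT (EFin \o phi) by exact: integrable_normal_pdf.
apply: ae_eq_integral => //.
- apply: emeasurable_funM => //.
  apply: measurable_int; exact: Radon_Nikodym_SigmaFinite.f_integrable.
- by apply: emeasurable_funM => //; exact: measurable_int iphi.
apply: ae_eqe_mul2l; apply: integral_ae_eq => //.
- exact: Radon_Nikodym_SigmaFinite.f_integrable.
- exact: measurable_int iphi.
- by move=> E _ mE; rewrite -Radon_Nikodym_SigmaFinite.f_integral.
Qed.

Lemma is_derive_normal_pdf (x : R) :
  is_derive x 1 phi (- ((x - m) / s ^+ 2 * phi x)).
Proof.
rewrite normal_pdfE// /normal_fun; apply: is_derive_eq.
rewrite /GRing.scale/= -mulr_natr expr2; field.
by rewrite s_neq0.
Qed.

End normal.

Definition normal_cdf {R : realType} (m s x : R) : R :=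
  fine (normal_prob m s `]-oo, x]).

(** * The fundamental theorem of calculus on half-lines and on the line *)

Section half_lines.
Context {R : realType}.
Local Notation mu := (@lebesgue_measure R).
Implicit Types (f F : R -> R) (a k l : R).

Lemma ge0_FTC2y f F a l : continuous f ->
  (forall x, a <= x -> 0 <= f x) -> (forall x : R, is_derive x 1 F (f x)) ->
  F x @[x --> +oo] --> l ->
  (\int[mu]_(x in `[a, +oo[) (f x)%:E = (l - F a)%:E)%E.
Proof.
move=> cf f0 dF Fl; rewrite (@ge0_continuous_FTC2y _ f F a l) ?EFinB//.
- exact: continuous_subspaceT.
- apply: cvg_at_right_filter; apply: differentiable_continuous.
  exact/derivable1_diffP.
- by move=> x _; rewrite derive1E derive_val.
Qed.

(** Reflection reduces this to [ge0_FTC2y]: [f (- x)] has antiderivative [- F (- x)], and the limit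
    of [F] at [-oo] becomes one at [+oo]. *)
Lemma ge0_FTC2Ny f F a k : continuous f ->
  (forall x, x <= a -> 0 <= f x) -> (forall x : R, is_derive x 1 F (f x)) ->
  F x @[x --> -oo] --> k ->
  (\int[mu]_(x in `]-oo, a]) (f x)%:E = (F a - k)%:E)%E.
Proof.
move=> cf f0 dF Fk.
have := @ge0_integration_by_substitutionNy R f (- a).
rewrite opprK => ->.
- have dG (x : R) : is_derive x 1 (\- (F \o -%R)) ((f \o -%R) x).
    have dFN : is_derive (- x) 1 F (f (- x)) by [].
    apply: is_derive_eq.
    by rewrite /= mulrN1 opprK.
  rewrite (@ge0_FTC2y (f \o -%R) (\- (F \o -%R)) (- a) (- k)) //=.
  + by rewrite opprK opprK addrC.
  + by move=> x; apply: continuous_comp; [exact: opp_continuous|exact: cf].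
  + by move=> x ax; apply: f0; rewrite lerNl.
  + by apply: cvgN; apply/cvgNy_compNP.
- exact: continuous_subspaceT.
- by move=> x; rewrite in_itv/= => /ltW /f0.
Qed.

Lemma ge0_integralT_split (f : R -> \bar R) a :
  measurable_fun [set: R] f -> (forall x, (0 <= f x)%E) ->
  (\int[mu]_x f x =
   \int[mu]_(x in `]-oo, a]) f x + \int[mu]_(x in `[a, +oo[) f x)%E.
Proof.
move=> mf f0; rewrite -(itv_setU_setT false a) ge0_integral_setU//=.
- rewrite -[in RHS]integral_itv_obnd_cbnd//; exact: measurable_funTS.
- exact: measurable_funTS.
- exact: disjoint_rays.
Qed.

Lemma ge0_FTC2T f F k l : continuous f -> (forall x, 0 <= f x) ->
  (forall x : R, is_derive x 1 F (f x)) ->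
  F x @[x --> -oo] --> k -> F x @[x --> +oo] --> l ->
  (\int[mu]_x (f x)%:E = (l - k)%:E)%E.
Proof.
move=> cf f0 dF Fk Fl; rewrite (@ge0_integralT_split _ 0)//=.
- rewrite (ge0_FTC2y _ _ dF Fl)// (ge0_FTC2Ny _ _ dF Fk)// -EFinD; congr EFin.
  ring.
- by apply/measurable_EFinP; exact: continuous_measurable_fun.
Qed.

End half_lines.

(** * The normal density and distribution function at infinity *)

Section normal_limits.
Context {R : realType} (m s : R).
Hypothesis s_gt0 : 0 < s.
Local Notation mu := (@lebesgue_measure R).
Local Notation phi := (normal_pdf m s).
Local Notation Phi := (normal_cdf m s).

Let s_neq0 : s != 0. Proof. by rewrite gt_eqF. Qed.

Lemma is_derive_normal_cdf (x : R) : is_derive x 1 Phi (phi x).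
Proof.
(* The first fundamental theorem differentiates only strictly inside the interval of integrability;
   [x + 1] is an arbitrary endpoint beyond [x]. *)
have iphi : mu.-integrable [set` Interval -oo%O (BRight (x + 1))] (EFin \o phi).
  by apply: integrableS (integrable_normal_pdf m s).
have [] := @continuous_FTC1 R phi -oo%O x (x + 1) _ iphi _ _.
- by rewrite ltrDl.
- by rewrite ltNyr.
- exact: continuous_normal_pdf.
by rewrite derive1E => dPhi PhiE; apply: DeriveDef.
Qed.

(* [normal_prob] lives on [measurableTypeR R], whose display is not that of the
   canonical measurable structure of [R]; the identity transports it. *)
Let idTR : measurableTypeR R -> R := idfun.

#[local] HB.instance Definition _ :=
  @isMeasurableFun.Build _ _ _ _ idTR (@measurable_id _ _ setT).

Lemma cvg_normal_cdfy : Phi x @[x --> +oo] --> (1 : R).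
Proof.
by have /fine_cvg := cvg_cdfy1 (idTR : {RV normal_prob m s >-> R}).
Qed.

Lemma cvg_normal_cdfNy : Phi x @[x --> -oo] --> (0 : R).
Proof.
by have /fine_cvg := cvg_cdfNy0 (idTR : {RV normal_prob m s >-> R}).
Qed.

(** With [u = (x - m) ^ 2 / (2 * s ^ 2)] this is [u * exp (- u) <= 1], a consequence of
    [1 + u <= exp u]. *)
Lemma sqr_normal_pdf_le x : (x - m) ^+ 2 * phi x <= normal_peak s * (s ^+ 2 *+ 2).
Proof.
rewrite normal_pdfE// mulrCA ler_wpM2l ?normal_peak_ge0// /normal_fun.
have s2 : 0 < s ^+ 2 *+ 2 by rewrite pmulrn_lgt0// exprn_gt0.
have := expR_ge1Dx ((x - m) ^+ 2 / (s ^+ 2 *+ 2)).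
rewrite mulNr expRN => le1.
have e0 := expR_gt0 ((x - m) ^+ 2 / (s ^+ 2 *+ 2)).
rewrite ler_pdivrMr// -ler_pdivrMl// mulrC.
by apply: le_trans le1; rewrite lerDr.
Qed.

(** By [sqr_normal_pdf_le], [(x - m) * phi x] is at most [C / |x - m|] in absolute value, and it
    dominates [phi x] once [|x - m| >= 1]. The abstract filter treats both infinities at once. *)
Lemma cvg_normal_pdf (F : set_system R) {FF : ProperFilter F} :
  `|x - m| @[x --> F] --> +oo ->
  phi x @[x --> F] --> (0 : R) /\ (x - m) * phi x @[x --> F] --> (0 : R).
Proof.
move=> Fy; set C := normal_peak s * (s ^+ 2 *+ 2).
have C0 : 0 <= C.
  by rewrite mulr_ge0 ?normal_peak_ge0// mulrn_wge0// sqr_ge0.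
have lim0 : C * `|x - m|^-1 @[x --> F] --> (0 : R).
  rewrite -(mulr0 C); apply: cvgM; first exact: cvg_cst.
  apply/gtr0_cvgV0; last exact: Fy.
  by have /cvgryPgt/(_ 0) := Fy.
have bnd x : 1 <= `|x - m| -> `|(x - m) * phi x| <= C * `|x - m|^-1.
  move=> x1; have x0 : 0 < `|x - m| by rewrite (lt_le_trans _ x1).
  rewrite ler_pdivlMr// normrM (ger0_norm (normal_pdf_ge0 _ _ _)).
  rewrite mulrAC -expr2 real_normK ?num_real//; exact: sqr_normal_pdf_le.
have Fx1 : \forall x \near F, 1 <= `|x - m| by have /cvgryPge/(_ 1) := Fy.
split; apply/cvgr0Pnorm_le => e e0.
- have /cvgr0Pnorm_le/(_ e e0) := lim0.
  move: Fx1; apply: filterS2 => x x1; apply: le_trans.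
  rewrite [leRHS]ger0_norm; last by rewrite mulr_ge0// invr_ge0.
  apply: le_trans (bnd _ x1).
  by rewrite normrM ler_peMl.
- have /cvgr0Pnorm_le/(_ e e0) := lim0.
  move: Fx1; apply: filterS2 => x x1; apply: le_trans.
  rewrite [leRHS]ger0_norm; last by rewrite mulr_ge0// invr_ge0.
  exact: bnd.
Qed.

Lemma cvg_normal_pdfy :
  phi x @[x --> +oo] --> (0 : R) /\ (x - m) * phi x @[x --> +oo] --> (0 : R).
Proof.
apply: cvg_normal_pdf; apply/cvgryPge => A; near=> x.
rewrite (le_trans _ (ler_norm _))// lerBrDr.
by near: x; apply: nbhs_pinfty_ge; rewrite num_real.
Unshelve. all: by end_near. Qed.

Lemma cvg_normal_pdfNy :
  phi x @[x --> -oo] --> (0 : R) /\ (x - m) * phi x @[x --> -oo] --> (0 : R).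
Proof.
apply: cvg_normal_pdf; apply/cvgryPge => A; near=> x.
rewrite -normrN (le_trans _ (ler_norm _))// opprB lerBrDr -lerBrDl.
by near: x; apply: nbhs_ninfty_le; rewrite num_real.
Unshelve. all: by end_near. Qed.

End normal_limits.

Lemma cvg_exprn {R : realType} {T : Type} (F : set_system T) {FF : Filter F}
    (f : T -> R) (a : R) (n : nat) :
  f x @[x --> F] --> a -> f x ^+ n @[x --> F] --> a ^+ n.
Proof.
move=> fa; apply: (@cvg_comp _ _ _ f (fun y : R => y ^+ n) _ _ _ fa).
exact: exprn_continuous.
Qed.

(** * Closed forms of the normal moments *)

Section normal_moments.
Context {R : realType} (m s : R).
Hypothesis s_gt0 : 0 < s.
Local Notation mu := (@lebesgue_measure R).
Local Notation phi := (normal_pdf m s).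
Local Notation Phi := (normal_cdf m s).

Let s_neq0 : s != 0. Proof. by rewrite gt_eqF. Qed.

Let dphi (x : R) : is_derive x 1 phi (- ((x - m) / s ^+ 2 * phi x)).
Proof. exact: is_derive_normal_pdf. Qed.
Local Existing Instance dphi.

Let dPhi (x : R) : is_derive x 1 Phi (phi x).
Proof. exact: is_derive_normal_cdf. Qed.
Local Existing Instance dPhi.

Let phi_ge0 x : 0 <= phi x. Proof. exact: normal_pdf_ge0. Qed.

Let continuous_phi : continuous phi.
Proof. exact: continuous_normal_pdf. Qed.

Let continuous_Phi : continuous Phi.
Proof.
move=> x; apply: differentiable_continuous; apply/derivable1_diffP.
by have := is_derive_normal_cdf m s_gt0 x => -[].
Qed.

Let continuousB (c : R) : continuous (fun x : R => x - c).
Proof. by move=> x; apply: cvgB; [exact: cvg_id|exact: cvg_cst]. Qed.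

Lemma ge0_integral_normal_probE (f : R -> R) : continuous f ->
  (forall x, 0 <= f x) ->
  (\int[normal_prob m s]_x (f x)%:E = \int[mu]_x (f x * phi x)%:E)%E.
Proof.
move=> cf f0; rewrite ge0_integral_normal_prob//.
by apply/measurable_EFinP; exact: continuous_measurable_fun.
Qed.

(** Closed form of the function [h(y) = E|X - y|]; [integral_normal_dist] justifies it. *)
Definition normal_absdev (y : R) : R :=
  (y - m) * (2 * Phi y - 1) + 2 * s ^+ 2 * phi y.

Lemma integral_normal_dist (y : R) :
  (\int[normal_prob m s]_x `|x - y|%:E = (normal_absdev y)%:E)%E.
Proof.
have cd : continuous (fun x : R => `|x - y|).
  by move=> x; apply: cvg_norm; exact: continuousB.
rewrite ge0_integral_normal_probE// (@ge0_integralT_split _ _ y); last 2 first.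
- apply/measurable_EFinP; apply: continuous_measurable_fun => x.
  by apply: cvgM; [exact: cd|exact: continuous_phi].
- by move=> x; rewrite lee_fin mulr_ge0.
(* Write [x - y] as [(x - m) - (y - m)] and use that [(x - m) * phi] is the derivative of
   [- s ^ 2 * phi]. The integrand is the derivative of [F] to the right of [y] and of [- F] to the
   left. *)
pose F x := - s ^+ 2 * phi x - (y - m) * Phi x.
have dF (x : R) : is_derive x 1 F ((x - y) * phi x).
  by rewrite /F; apply: is_derive_eq; rewrite /GRing.scale/=; field.
have dNF (x : R) : is_derive x 1 (\- F) ((y - x) * phi x).
  by apply: is_derive_eq; rewrite -mulNr opprB.
have cF : continuous (fun x => (x - y) * phi x).
  by move=> x; apply: cvgM; [exact: continuousB|exact: continuous_phi].
have cNF : continuous (fun x => (y - x) * phi x).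
  move=> x; apply: cvgM; last exact: continuous_phi.
  by apply: cvgB; [exact: cvg_cst|exact: cvg_id].
have [phiy _] := cvg_normal_pdfy m s_gt0.
have [phiNy _] := cvg_normal_pdfNy m s_gt0.
have Fy : F x @[x --> +oo] --> - s ^+ 2 * 0 - (y - m) * 1.
  apply: cvgB; apply: cvgM => //; try exact: cvg_cst.
  exact: cvg_normal_cdfy.
have FNy : (\- F) x @[x --> -oo] --> - (- s ^+ 2 * 0 - (y - m) * 0).
  apply: cvgN; apply: cvgB; apply: cvgM => //; try exact: cvg_cst.
  exact: cvg_normal_cdfNy.
have -> : (\int[mu]_(x in `[y, +oo[) (`|x - y| * phi x)%:E =
           \int[mu]_(x in `[y, +oo[) ((x - y) * phi x)%:E)%E.
  apply: eq_integral => x; rewrite inE/= in_itv/= andbT => yx.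
  by rewrite ger0_norm// subr_ge0.
have -> : (\int[mu]_(x in `]-oo, y]) (`|x - y| * phi x)%:E =
           \int[mu]_(x in `]-oo, y]) ((y - x) * phi x)%:E)%E.
  apply: eq_integral => x; rewrite inE/= in_itv/= => yx.
  by rewrite distrC ger0_norm// subr_ge0.
rewrite (ge0_FTC2y cF _ dF Fy); last by move=> x yx; rewrite mulr_ge0// subr_ge0.
rewrite (ge0_FTC2Ny cNF _ dNF FNy); last by move=> x yx; rewrite mulr_ge0// subr_ge0.
rewrite -EFinD /= /F /normal_absdev; congr EFin; ring.
Qed.

Lemma normal_absdev_ge0 y : 0 <= normal_absdev y.
Proof. by rewrite -lee_fin -integral_normal_dist; exact: integral_ge0. Qed.

Lemma continuous_normal_absdev : continuous normal_absdev.
Proof.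
move=> x; apply: cvgD; apply: cvgM; last exact: continuous_phi.
- exact: continuousB.
- apply: cvgB; last exact: cvg_cst.
  by apply: cvgM; [exact: cvg_cst|exact: continuous_Phi].
- exact: cvg_cst.
Qed.

Lemma measurable_normal_absdev : measurable_fun [set: R] normal_absdev.
Proof. by apply: continuous_measurable_fun; exact: continuous_normal_absdev. Qed.

(** The [k]-th power multiplies the Gaussian exponent by [k], that is, divides the variance by [k];
    the prefactor corrects the peak. The cases 2 and 3 supply antiderivatives of [phi ^ 2] and
    [phi ^ 3]. *)
Lemma normal_pdfX (k : nat) (x : R) : (0 < k)%N ->
  phi x ^+ k = normal_peak s ^+ k.-1 / Num.sqrt k%:R *
    normal_pdf m (s / Num.sqrt k%:R) x.
Proof.
move=> k0; have k0R : 0 < k%:R :> R by rewrite ltr0n.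
have sk0 : 0 < Num.sqrt k%:R :> R by rewrite sqrtr_gt0.
have sk2 : Num.sqrt k%:R ^+ 2 = k%:R :> R by rewrite sqr_sqrtr ?ler0n.
rewrite !normal_pdfE//; last by rewrite gt_eqF// divr_gt0.
have -> : normal_peak (s / Num.sqrt k%:R) = Num.sqrt k%:R * normal_peak s.
  rewrite /normal_peak expr_div_n sk2 -!mulrnAr mulrAC sqrtrM; last first.
    by rewrite mulr_ge0 ?sqr_ge0// mulrn_wge0// pi_ge0.
  by rewrite sqrtrV ?ler0n// invfM invrK mulrC.
rewrite exprMn -{1}(prednK k0) exprSr /normal_fun -expRM_natl.
rewrite !mulrA divfK ?gt_eqF//; congr (_ * expR _).
rewrite expr_div_n sk2 !mulr2n; field.
by rewrite !gt_eqF// addr_gt0 ?exprn_gt0.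
Qed.

Lemma sqr_normal_peak : normal_peak s ^+ 2 = (2 * s ^+ 2 * pi)^-1.
Proof.
rewrite /normal_peak exprVn sqr_sqrtr; last first.
  by rewrite mulrn_wge0// mulr_ge0 ?sqr_ge0// pi_ge0.
by rewrite -mulr_natr mulrC mulrA.
Qed.

Lemma normal_peakE : normal_peak s = (s * Num.sqrt 2 * Num.sqrt pi)^-1.
Proof.
rewrite /normal_peak -mulrnAr sqrtrM ?sqr_ge0// sqrtr_sqr gtr0_norm//.
by rewrite -mulr_natl sqrtrM// mulrA.
Qed.

Lemma integral_normal_absdev :
  (\int[normal_prob m s]_y (normal_absdev y)%:E = (2 * s / Num.sqrt pi)%:E)%E.
Proof.
have ck := continuous_normal_absdev.
have k0 := normal_absdev_ge0.
rewrite ge0_integral_normal_probE//.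
pose t := s / Num.sqrt 2.
have t0 : 0 < t by rewrite divr_gt0// sqrtr_gt0.
pose c := normal_peak s / Num.sqrt 2.
(* The first summand has derivative [(y - m) * (2 * Phi y - 1) * phi y - 2 * s ^ 2 * phi y ^ 2].
   What is missing is [4 * s ^ 2 * phi ^ 2], and [phi ^ 2] is [c] times the density of standard
   deviation [t]. *)
pose F (y : R) := - (s ^+ 2) * ((2 * Phi y - 1) * phi y)
  + 4 * s ^+ 2 * c * normal_cdf m t y.
have dt (x : R) : is_derive x 1 (normal_cdf m t) (normal_pdf m t x).
  exact: is_derive_normal_cdf.
have dF (x : R) : is_derive x 1 F (normal_absdev x * phi x).
  have sq : phi x ^+ 2 = c * normal_pdf m t x by rewrite normal_pdfX.
  rewrite /F; apply: is_derive_eq; rewrite /GRing.scale/=.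
  have -> : 4 * s ^+ 2 * c * normal_pdf m t x = 4 * s ^+ 2 * phi x ^+ 2.
    by rewrite sq; ring.
  by rewrite /normal_absdev; field.
have [phiy _] := cvg_normal_pdfy m s_gt0.
have [phiNy _] := cvg_normal_pdfNy m s_gt0.
have Fy : F x @[x --> +oo] --> - (s ^+ 2) * ((2 * 1 - 1) * 0) + 4 * s ^+ 2 * c * 1.
  apply: cvgD; apply: cvgM; try exact: cvg_cst; last exact: cvg_normal_cdfy.
  apply: cvgM => //; apply: cvgB; last exact: cvg_cst.
  by apply: cvgM; [exact: cvg_cst|exact: cvg_normal_cdfy].
have FNy : F x @[x --> -oo] --> - (s ^+ 2) * ((2 * 0 - 1) * 0) + 4 * s ^+ 2 * c * 0.
  apply: cvgD; apply: cvgM; try exact: cvg_cst; last exact: cvg_normal_cdfNy.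
  apply: cvgM => //; apply: cvgB; last exact: cvg_cst.
  by apply: cvgM; [exact: cvg_cst|exact: cvg_normal_cdfNy].
have cf : continuous (fun x => normal_absdev x * phi x).
  by move=> x; apply: cvgM; [exact: ck|exact: continuous_phi].
rewrite (ge0_FTC2T cf _ dF FNy Fy); last by move=> x; rewrite mulr_ge0.
congr EFin; rewrite /c normal_peakE !mulr0 !add0r subr0 mulr1.
have s2 : Num.sqrt 2 ^+ 2 = 2 :> R by rewrite sqr_sqrtr.
have s20 : Num.sqrt 2 != 0 :> R by rewrite sqrtr_eq0 -ltNge.
have sp0 : Num.sqrt pi != 0 :> R by rewrite sqrtr_eq0 -ltNge pi_gt0.
apply: (mulIf s20); apply: (mulIf s20).
transitivity (4 * s / Num.sqrt pi : R).
  by field; rewrite s20 sp0 s_neq0.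
by rewrite -[RHS]mulrA -expr2 s2; field.
Qed.

(** The term [s ^ 2 / 3] is the increment of [s ^ 2 / 6 * A ^ 3] as [A = 2 * Phi - 1] runs from -1
    to 1; the term with [sqrt 3] is the total mass [12 * s ^ 4 * c] of the [phi ^ 3] part. *)
Lemma integral_sqr_normal_absdev :
  (\int[normal_prob m s]_y (normal_absdev y ^+ 2)%:E =
   (s ^+ 2 * (3^-1 + 2 * Num.sqrt 3 / pi))%:E)%E.
Proof.
have ck : continuous (fun x => normal_absdev x ^+ 2).
  by move=> x; apply: cvg_exprn; exact: continuous_normal_absdev.
rewrite (ge0_integral_normal_probE ck); last by move=> x; exact: sqr_ge0.
pose t := s / Num.sqrt 3.
have t0 : 0 < t by rewrite divr_gt0// sqrtr_gt0.
pose c := normal_peak s ^+ 2 / Num.sqrt 3.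
pose A (y : R) := 2 * Phi y - 1.
(* Integration by parts with phi' = - (y - m) / s ^+ 2 * phi and A' = 2 * phi
   leaves 12 * s ^+ 4 * phi ^+ 3, a multiple of the normal density of standard
   deviation s / sqrt 3. *)
pose F (y : R) := - (s ^+ 2) * (A y ^+ 2 * ((y - m) * phi y))
  + s ^+ 2 / 6 * A y ^+ 3 - 4 * s ^+ 4 * (A y * phi y ^+ 2)
  + 12 * s ^+ 4 * c * normal_cdf m t y.
have dt (x : R) : is_derive x 1 (normal_cdf m t) (normal_pdf m t x).
  exact: is_derive_normal_cdf.
have dF (x : R) : is_derive x 1 F (normal_absdev x ^+ 2 * phi x).
  have sq : phi x ^+ 3 = c * normal_pdf m t x by rewrite normal_pdfX.
  rewrite /F /A; apply: is_derive_eq; rewrite /GRing.scale/=.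
  have -> : 12 * s ^+ 4 * c * normal_pdf m t x = 12 * s ^+ 4 * phi x ^+ 3.
    by rewrite sq; ring.
  by rewrite /normal_absdev; field.
have [phiy zphiy] := cvg_normal_pdfy m s_gt0.
have [phiNy zphiNy] := cvg_normal_pdfNy m s_gt0.
have Ay : A x @[x --> +oo] --> (2 * 1 - 1 : R).
  apply: cvgB; last exact: cvg_cst.
  by apply: cvgM; [exact: cvg_cst|exact: cvg_normal_cdfy].
have ANy : A x @[x --> -oo] --> (2 * 0 - 1 : R).
  apply: cvgB; last exact: cvg_cst.
  by apply: cvgM; [exact: cvg_cst|exact: cvg_normal_cdfNy].
have Fy : F x @[x --> +oo] --> - (s ^+ 2) * ((2 * 1 - 1) ^+ 2 * 0)
    + s ^+ 2 / 6 * (2 * 1 - 1) ^+ 3 - 4 * s ^+ 4 * ((2 * 1 - 1) * 0 ^+ 2)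
    + 12 * s ^+ 4 * c * 1.
  apply: cvgD; last by apply: cvgM; [exact: cvg_cst|exact: cvg_normal_cdfy].
  apply: cvgB; first apply: cvgD; apply: cvgM; try exact: cvg_cst.
  - by apply: cvgM => //; exact: cvg_exprn.
  - exact: cvg_exprn.
  - by apply: cvgM => //; exact: cvg_exprn.
have FNy : F x @[x --> -oo] --> - (s ^+ 2) * ((2 * 0 - 1) ^+ 2 * 0)
    + s ^+ 2 / 6 * (2 * 0 - 1) ^+ 3 - 4 * s ^+ 4 * ((2 * 0 - 1) * 0 ^+ 2)
    + 12 * s ^+ 4 * c * 0.
  apply: cvgD; last by apply: cvgM; [exact: cvg_cst|exact: cvg_normal_cdfNy].
  apply: cvgB; first apply: cvgD; apply: cvgM; try exact: cvg_cst.
  - by apply: cvgM => //; exact: cvg_exprn.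
  - exact: cvg_exprn.
  - by apply: cvgM => //; exact: cvg_exprn.
have cf : continuous (fun x => normal_absdev x ^+ 2 * phi x).
  by move=> x; apply: cvgM; [exact: ck|exact: continuous_phi].
rewrite (ge0_FTC2T cf _ dF FNy Fy); last by move=> x; rewrite mulr_ge0// sqr_ge0.
congr EFin; rewrite /c sqr_normal_peak.
have s3 : Num.sqrt 3 ^+ 2 = 3 :> R by rewrite sqr_sqrtr.
have s30 : Num.sqrt 3 != 0 :> R by rewrite sqrtr_eq0 -ltNge.
have p0 : pi != 0 :> R by rewrite gt_eqF// pi_gt0.
have -> : (Num.sqrt 3)^-1 = Num.sqrt 3 / 3 :> R.
  by rewrite -[X in _ / X]s3; field.
by move: pi p0 => p p0; field; rewrite p0 s_neq0.
Qed.

Lemma integral_normal_sqr_dist (y : R) :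
  (\int[normal_prob m s]_x ((x - y) ^+ 2)%:E = (s ^+ 2 + (y - m) ^+ 2)%:E)%E.
Proof.
have cd : continuous (fun x : R => (x - y) ^+ 2).
  by move=> x; apply: cvg_exprn; exact: continuousB.
rewrite (ge0_integral_normal_probE cd); last by move=> x; exact: sqr_ge0.
(* Expand [(x - y) ^ 2] around [m]: the first term together with [s ^ 2 * Phi] accounts for
   [(x - m) ^ 2 * phi], the second for the cross term. *)
pose F (x : R) := - (s ^+ 2) * ((x - m) * phi x) + 2 * (y - m) * s ^+ 2 * phi x
  + (s ^+ 2 + (y - m) ^+ 2) * Phi x.
have dF (x : R) : is_derive x 1 F ((x - y) ^+ 2 * phi x).
  by rewrite /F; apply: is_derive_eq; rewrite /GRing.scale/=; field.
have [phiy zphiy] := cvg_normal_pdfy m s_gt0.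
have [phiNy zphiNy] := cvg_normal_pdfNy m s_gt0.
have Fy : F x @[x --> +oo] --> - (s ^+ 2) * 0 + 2 * (y - m) * s ^+ 2 * 0
    + (s ^+ 2 + (y - m) ^+ 2) * 1.
  apply: cvgD; first apply: cvgD; apply: cvgM => //; try exact: cvg_cst.
  exact: cvg_normal_cdfy.
have FNy : F x @[x --> -oo] --> - (s ^+ 2) * 0 + 2 * (y - m) * s ^+ 2 * 0
    + (s ^+ 2 + (y - m) ^+ 2) * 0.
  apply: cvgD; first apply: cvgD; apply: cvgM => //; try exact: cvg_cst.
  exact: cvg_normal_cdfNy.
have cf : continuous (fun x => (x - y) ^+ 2 * phi x).
  by move=> x; apply: cvgM; [exact: cd|exact: continuous_phi].
rewrite (ge0_FTC2T cf _ dF FNy Fy); last by move=> x; rewrite mulr_ge0// sqr_ge0.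
by congr EFin; ring.
Qed.

End normal_moments.

(** * Independence *)

Section independence.
Context {R : realType} {d d1 d2 : measure_display} {Omega : measurableType d}
  {T1 : measurableType d1} {T2 : measurableType d2} (P : probability Omega R).
Local Open Scope ereal_scope.

(** Factorisation on rectangles identifies the joint law with the product of the two laws, by
    uniqueness of the product measure; Tonelli then iterates the integral. *)
Lemma ge0_integral_indep_pair (U : {mfun Omega >-> T1}) (V : {mfun Omega >-> T2})
    (f : T1 * T2 -> \bar R) :
  (forall A B, measurable A -> measurable B ->
    P (U @^-1` A `&` V @^-1` B) = P (U @^-1` A) * P (V @^-1` B)) ->
  measurable_fun [set: T1 * T2] f -> (forall z, 0 <= f z) ->
  \int[P]_w f (U w, V w) =
  \int[distribution P U]_u \int[distribution P V]_v f (u, v).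
Proof.
move=> UV mf f0.
have mW : measurable_fun [set: Omega] (fun w => (U w, V w)).
  exact: measurable_fun_pair.
pose W : {mfun Omega >-> (T1 * T2)%type} :=
  HB.pack (fun w => (U w, V w)) (isMeasurableFun.Build _ _ _ _ _ mW).
rewrite -(@ge0_integral_distribution _ _ _ _ _ P W f)//.
rewrite (@eq_measure_integral _ _ _ _ (distribution P U \x distribution P V)%E).
  by rewrite fubini_tonelli1.
move=> A mA _; apply/esym/product_measure_unique => //.
Qed.

(** Both sides are finite measures in [C] that agree on rectangles, which are stable under
    intersection and generate the product sigma-algebra. This lets a pair of coordinates act as one
    random variable in [ge0_integral_indep_pair]. *)
Lemma indep_pair_event (U : {mfun Omega >-> T1}) (V : {mfun Omega >-> T2})
    (E : set Omega) : measurable E ->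
  (forall A B, measurable A -> measurable B ->
    P (U @^-1` A `&` V @^-1` B `&` E) = P (U @^-1` A `&` V @^-1` B) * P E) ->
  forall C, measurable C ->
    P ((fun w => (U w, V w)) @^-1` C `&` E) =
    P ((fun w => (U w, V w)) @^-1` C) * P E.
Proof.
move=> mE UVE C mC.
have mW : measurable_fun [set: Omega] (fun w => (U w, V w)).
  exact: measurable_fun_pair.
pose W : {mfun Omega >-> (T1 * T2)%type} :=
  HB.pack (fun w => (U w, V w)) (isMeasurableFun.Build _ _ _ _ _ mW).
pose c : {nonneg R} := NngNum (fine_ge0 (measure_ge0 P E)).
pose m1 := pushforward (mrestr P mE) W.
pose m2 := mscale c (distribution P W).
have cE : c%:num%:E = P E by rewrite /c/= fineK// fin_num_measure.
rewrite muleC -cE.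
apply: (@measure_unique _ R (T1 * T2)%type
  [set A `*` B | A in measurable & B in measurable] (fun=> setT)
  _ _ _ _ m1 m2) => //.
- exact: measurable_prod_measurableType.
- move=> _ _ [A1 mA1 [B1 mB1 <-]] [A2 mA2 [B2 mB2 <-]].
  exists (A1 `&` A2); first exact: measurableI.
  by exists (B1 `&` B2); [exact: measurableI|rewrite setXI].
- by move=> _; exists setT => //; exists setT => //; rewrite setXTT.
- by rewrite bigcup_const.
- by move=> _ [A mA [B mB <-]]; rewrite /m2/= /mscale cE muleC -UVE.
- have m1T : m1 setT = P E.
    by congr (P _); apply/seteqP; split => w //= [].
  have : m1 setT < +oo by rewrite m1T -ge0_fin_numE// fin_num_measure.
  by [].
Qed.

(** By independence, the image under [U] of [P] restricted to [E] is [P E] times the law of [U]. *)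
Lemma ge0_integral_indep_event (U : {mfun Omega >-> T1}) (E : set Omega)
    (f : T1 -> \bar R) : measurable E ->
  (forall A, measurable A -> P (U @^-1` A `&` E) = P (U @^-1` A) * P E) ->
  measurable_fun [set: T1] f -> (forall z, 0 <= f z) ->
  \int[P]_(w in E) f (U w) = P E * \int[P]_w f (U w).
Proof.
move=> mE UE mf f0.
pose c : {nonneg R} := NngNum (fine_ge0 (measure_ge0 P E)).
have cE : c%:num%:E = P E by rewrite /c/= fineK// fin_num_measure.
have mfU : measurable_fun [set: Omega] (f \o U) by exact: measurableT_comp.
rewrite (@eq_measure_integral _ _ _ E (mrestr P mE)); last first.
  by move=> A mA AE; rewrite /= /mrestr setIidl.
(* The restricted measure vanishes off [E], so the domain can be enlarged to the whole space, where
   the push-forward formula applies. *)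
transitivity (\int[mrestr P mE]_w (f \o U) w).
  rewrite -[in RHS](setUv E) ge0_integral_setU//=; last 3 first.
  - by apply: measurableC.
  - by rewrite setUv.
  - by rewrite disj_set2E setICr.
  rewrite (@null_set_integral _ _ _ _ (~` E)) ?adde0//=.
  - exact: measurableC.
  - exact: measurable_funTS.
  - by rewrite /mrestr setICl measure0.
rewrite -(@ge0_integral_pushforward _ _ _ _ _ U _ (mrestr P mE) setT f)//.
rewrite (@eq_measure_integral _ _ _ _ (mscale c (distribution P U))).
  rewrite ge0_integral_mscale// ge0_integral_distribution//.
  by congr (_ * _); exact: cE.
by move=> A mA _; rewrite -[RHS]/(c%:num%:E * P (U @^-1` A)) cE muleC -UE.
Qed.

End independence.

(** * Moments of pairwise distances *)

Section iid_normal_moments.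
Context {R : realType} {d : measure_display} {Omega : measurableType d}
  (P : probability Omega R) (n : nat) (X : 'I_n -> {RV P >-> R}) (m s : R).
Hypotheses (s_gt0 : 0 < s) (X_iid : iid_normal X m s).
Local Open Scope ereal_scope.
Implicit Types (i j k l : 'I_n) (A B C D : set R).

Let idTR : measurableTypeR R -> R := idfun.

#[local] HB.instance Definition _ :=
  @isMeasurableFun.Build _ _ _ _ idTR (@measurable_id _ _ setT).

Let integral_X i (f : R -> \bar R) :
  measurable_fun [set: R] f -> (forall x, 0 <= f x) ->
  \int[distribution P (X i)]_x f x = \int[normal_prob m s]_x f x.
Proof.
move=> mf f0.
rewrite (@eq_measure_integral _ _ _ _
  (distribution (normal_prob m s) (idTR : {mfun _ >-> _}))).
  by rewrite ge0_integral_distribution.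
by move=> A mA _; exact: X_iid.1.
Qed.

Let mXA i A : measurable A -> measurable (X i @^-1` A).
Proof. by move=> mA; exact: measurable_funPTI. Qed.

Lemma mutually_independent_seq (r : seq 'I_n) (B : 'I_n -> set R) : uniq r ->
  (forall i, measurable (B i)) ->
  P [set w | forall i, i \in r -> B i (X i w)] =
  \prod_(i <- r) P (X i @^-1` B i).
Proof.
move=> ur mB; rewrite big_uniq//=.
have := X_iid.2 [set i in r]%SET B mB.
rewrite (eq_bigl (mem r)) => [<-|i]; last by rewrite inE.
by congr (P _); apply/seteqP; split=> w /= Bw i; have := Bw i; rewrite inE.
Qed.

Lemma indep2 i j A B : i != j -> measurable A -> measurable B ->
  P (X i @^-1` A `&` X j @^-1` B) = P (X i @^-1` A) * P (X j @^-1` B).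
Proof.
move=> ij mA mB.
(* The last set doubles as the default, since only the listed indices are constrained; likewise for
   three and four indices. *)
pose F r := if r == i then A else B.
have := @mutually_independent_seq [:: i; j] F.
rewrite !big_cons big_nil mule1 /F eqxx [j == i]eq_sym (negbTE ij) => <-.
- congr (P _); apply/seteqP; split => w /=.
    by move=> [Aw Bw] r; rewrite !inE => /orP[]/eqP ->;
      rewrite ?eqxx// eq_sym (negbTE ij).
  move=> H; split; first by have := H i; rewrite eqxx; apply; rewrite inE eqxx.
  by have := H j; rewrite eq_sym (negbTE ij); apply; rewrite !inE eqxx orbT.
- by rewrite /= inE ij.
- by move=> r; case: ifP.
Qed.

Lemma indep3 i j k A B C : uniq [:: i; j; k] ->
  measurable A -> measurable B -> measurable C ->
  P (X i @^-1` A `&` X j @^-1` B `&` X k @^-1` C) =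
  P (X i @^-1` A `&` X j @^-1` B) * P (X k @^-1` C).
Proof.
move=> u mA mB mC.
move: (u); rewrite /= !inE andbT negb_or => /andP[/andP[ij ik] jk].
have E : ((j == i) = false) * ((k == i) = false) * ((k == j) = false).
  by do !split; rewrite eq_sym; exact: negbTE.
rewrite indep2//.
pose F r := if r == i then A else if r == j then B else C.
have := @mutually_independent_seq _ F u.
rewrite !big_cons big_nil mule1 /F !eqxx !E muleA => <-.
- congr (P _); apply/seteqP; split => w /=.
    move=> [[Aw Bw] Cw] r; rewrite !inE => /or3P[]/eqP ->;
      by rewrite ?eqxx ?E ?eqxx.
  move=> H; split; first split.
  + by have := H i; rewrite eqxx; apply; rewrite inE eqxx.
  + have := H j; rewrite E eqxx; apply.
    by rewrite !inE eqxx orbT.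
  + have := H k; rewrite !E; apply.
    by rewrite !inE eqxx !orbT.
- by move=> r; do ![case: ifP => // _].
Qed.

Lemma indep4 i j k l A B C D : uniq [:: i; j; k; l] ->
  measurable A -> measurable B -> measurable C -> measurable D ->
  P (X i @^-1` A `&` X j @^-1` B `&` (X k @^-1` C `&` X l @^-1` D)) =
  P (X i @^-1` A `&` X j @^-1` B) * P (X k @^-1` C `&` X l @^-1` D).
Proof.
move=> u mA mB mC mD.
move: (u); rewrite /= !inE andbT !negb_or.
move=> /andP[/and3P[ij ik il] /andP[/andP[jk jl] kl]].
have E : ((j == i) = false) * ((k == i) = false) * ((k == j) = false) *
    ((l == i) = false) * ((l == j) = false) * ((l == k) = false).
  by do !split; rewrite eq_sym; exact: negbTE.
rewrite !indep2//.
pose F r := if r == i then A else if r == j then B else if r == k then C else D.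
have := @mutually_independent_seq _ F u.
rewrite !big_cons big_nil mule1 /F !eqxx !E muleA => <-.
- congr (P _); apply/seteqP; split => w /=.
    move=> [[Aw Bw] [Cw Dw]] r.
    rewrite !inE => /or4P[]/eqP ->;
      by rewrite ?eqxx ?E ?eqxx.
  move=> H; split; split.
  + by have := H i; rewrite eqxx; apply; rewrite inE eqxx.
  + have := H j; rewrite E eqxx; apply.
    by rewrite !inE eqxx orbT.
  + have := H k; rewrite !E eqxx; apply.
    by rewrite !inE eqxx !orbT.
  + have := H l; rewrite !E.
    by apply; rewrite !inE eqxx !orbT.
- by move=> r; do ![case: ifP => // _].
Qed.

Let absd (x y : R) : R := `|x - y|%R.

Let Xdiff i j w : R := absd (X i w) (X j w).

Let measurable_absd2 : measurable_fun [set: R * R] (fun z : R * R => absd z.1 z.2).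
Proof. by apply: measurableT_comp => //; exact: measurable_funB. Qed.

Let measurable_absdr (c : R) : measurable_fun [set: R] (absd c).
Proof. by apply: measurableT_comp => //; exact: measurable_funB. Qed.

Let measurable_absdl (c : R) : measurable_fun [set: R] (absd^~ c).
Proof. by apply: measurableT_comp => //; exact: measurable_funB. Qed.

Let absd_ge0 (x y : R) : (0 <= absd x y)%R. Proof. exact: normr_ge0. Qed.

Lemma integral_iid_dist i j : i != j ->
  \int[P]_w (Xdiff i j w)%:E = (2 * s / Num.sqrt pi)%:E.
Proof.
move=> ij.
rewrite (@ge0_integral_indep_pair _ _ _ _ _ _ _ P (X i) (X j)
  (fun z => (absd z.1 z.2)%:E)) /=; first last.
- by move=> z; rewrite lee_fin.
- exact/measurable_EFinP.
- by move=> A B mA mB; exact: indep2.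
have inner u : \int[distribution P (X j)]_v (absd u v)%:E =
    (normal_absdev m s u)%:E.
  rewrite integral_X//; last 2 first.
  - exact/measurable_EFinP.
  - by move=> v; rewrite lee_fin.
  by rewrite -integral_normal_dist//; apply: eq_integral => x _; rewrite distrC.
under eq_integral do rewrite inner.
rewrite integral_X ?integral_normal_absdev//.
- apply/measurable_EFinP; exact: measurable_normal_absdev.
- by move=> x; rewrite lee_fin normal_absdev_ge0.
Qed.

Lemma integral_iid_sqr_dist i j : i != j ->
  \int[P]_w (Xdiff i j w * Xdiff i j w)%:E = (2 * s ^+ 2)%:E.
Proof.
move=> ij.
rewrite (@ge0_integral_indep_pair _ _ _ _ _ _ _ P (X i) (X j)
  (fun z => (absd z.1 z.2 * absd z.1 z.2)%:E)) /=; first last.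
- by move=> z; rewrite lee_fin mulr_ge0.
- by apply/measurable_EFinP; exact: measurable_funM.
- by move=> A B mA mB; exact: indep2.
have inner u : \int[distribution P (X j)]_v (absd u v * absd u v)%:E =
    (s ^+ 2 + (u - m) ^+ 2)%:E.
  rewrite integral_X//; last 2 first.
  - by apply/measurable_EFinP; exact: measurable_funM.
  - by move=> z; rewrite lee_fin mulr_ge0.
  rewrite -integral_normal_sqr_dist//; apply: eq_integral => x _.
  by rewrite -expr2 real_normK ?num_real// -sqrrN opprB.
under eq_integral do rewrite inner.
have mq : measurable_fun [set: R] (fun u : R => ((u - m) ^+ 2)%R).
  by apply: measurable_funX; exact: measurable_funB.
rewrite integral_X//; last 2 first.
- by apply/measurable_EFinP; exact: measurable_funD.
- by move=> x; rewrite lee_fin addr_ge0 ?sqr_ge0.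
under eq_integral do rewrite EFinD.
rewrite ge0_integralD//=; last 3 first.
- by move=> x _; rewrite lee_fin sqr_ge0.
- by move=> x _; rewrite lee_fin sqr_ge0.
- exact/measurable_EFinP.
rewrite integral_cst//= probability_setT mule1 integral_normal_sqr_dist//.
by rewrite subrr expr0n/= addr0 -EFinD mulr_natl mulr2n.
Qed.

Lemma integral_iid_dist_shared i j k : uniq [:: i; j; k] ->
  \int[P]_w (Xdiff i k w * Xdiff j k w)%:E =
  (s ^+ 2 * (3^-1 + 2 * Num.sqrt 3 / pi))%:E.
Proof.
move=> u; move: (u); rewrite /= !inE andbT negb_or => /andP[/andP[ij ik] jk].
have mW : measurable_fun [set: Omega] (fun w => (X i w, X j w)).
  exact: measurable_fun_pair.
pose W : {mfun Omega >-> (R * R)%type} :=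
  HB.pack (fun w => (X i w, X j w)) (isMeasurableFun.Build _ _ _ _ _ mW).
(* The shared entry is the outer variable; for each of its values the inner integral over the pair
   [W] splits into two equal factors. *)
rewrite (@ge0_integral_indep_pair _ _ _ _ _ _ _ P (X k) W
  (fun z => (absd z.2.1 z.1 * absd z.2.2 z.1)%:E)) /=; first last.
- by move=> z; rewrite lee_fin mulr_ge0.
- apply/measurable_EFinP; apply: measurable_funM.
    exact: (measurableT_comp measurable_absd2 (measurable_fun_pair
      (measurableT_comp measurable_fst measurable_snd) measurable_fst)).
  exact: (measurableT_comp measurable_absd2 (measurable_fun_pair
    (measurableT_comp measurable_snd measurable_snd) measurable_fst)).
- move=> A B mA mB; rewrite setIC muleC.
  apply: (indep_pair_event (mXA k mA) _ mB) => C D mC mD.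
  exact: indep3.
have inner y : \int[distribution P W]_z (absd z.1 y * absd z.2 y)%:E =
    (normal_absdev m s y ^+ 2)%:E.
  rewrite ge0_integral_distribution/=; last 2 first.
  - apply/measurable_EFinP; apply: measurable_funM;
      exact: (measurableT_comp (measurable_absdl y)).
  - by move=> z; rewrite lee_fin mulr_ge0.
  rewrite (@ge0_integral_indep_pair _ _ _ _ _ _ _ P (X i) (X j)
    (fun z => (absd z.1 y * absd z.2 y)%:E)) /=; first last.
  - by move=> z; rewrite lee_fin mulr_ge0.
  - apply/measurable_EFinP; apply: measurable_funM;
      exact: (measurableT_comp (measurable_absdl y)).
  - by move=> A B mA mB; exact: indep2.
  (* Used twice: first with [c] the other distance, then, after commuting the product, with [c] the
     mean already obtained. *)
  have scale c k' : (0 <= c)%R ->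
      \int[distribution P (X k')]_v (c * absd v y)%:E =
      (c * normal_absdev m s y)%:E.
    move=> c0; under eq_integral do rewrite EFinM.
    rewrite ge0_integralZl//; last 2 first.
    - exact/measurable_EFinP.
    - by move=> v _; rewrite lee_fin.
    rewrite integral_X; last 2 first.
    - exact/measurable_EFinP.
    - by move=> v; rewrite lee_fin.
    by rewrite integral_normal_dist// EFinM.
  under eq_integral => x _ do rewrite scale// mulrC.
  by rewrite scale ?normal_absdev_ge0.
under eq_integral do rewrite inner.
rewrite integral_X ?integral_sqr_normal_absdev//.
- apply/measurable_EFinP; apply: measurable_funX.
  exact: measurable_normal_absdev.
- by move=> x; rewrite lee_fin sqr_ge0.
Qed.

Lemma integral_iid_dist_disjoint i j k l : uniq [:: i; j; k; l] ->
  \int[P]_w (Xdiff i j w * Xdiff k l w)%:E = ((2 * s / Num.sqrt pi) ^+ 2)%:E.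
Proof.
move=> u; move: (u); rewrite /= !inE andbT !negb_or.
move=> /andP[/and3P[ij ik il] /andP[/andP[jk jl] kl]].
have mW i' j' : measurable_fun [set: Omega] (fun w => (X i' w, X j' w)).
  exact: measurable_fun_pair.
pose W i' j' : {mfun Omega >-> (R * R)%type} :=
  HB.pack (fun w => (X i' w, X j' w)) (isMeasurableFun.Build _ _ _ _ _ (mW i' j')).
rewrite (@ge0_integral_indep_pair _ _ _ _ _ _ _ P (W i j) (W k l)
  (fun z => (absd z.1.1 z.1.2 * absd z.2.1 z.2.2)%:E)) /=; first last.
- by move=> z; rewrite lee_fin mulr_ge0.
- apply/measurable_EFinP; apply: measurable_funM.
    exact: (measurableT_comp measurable_absd2).
  exact: (measurableT_comp measurable_absd2).
- move=> A B mA mB.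
  (* Two extensions from rectangles: first for the pair [(i, j)] with the event on [(k, l)] fixed,
     then for [(k, l)] against a rectangle of [(i, j)], where [indep4] applies. *)
  apply: (@indep_pair_event _ _ _ _ _ _ _ P (X i) (X j)
    _ (measurable_funPTI (W k l) mB)) => // C D mC mD.
  rewrite setIC muleC.
  apply: (@indep_pair_event _ _ _ _ _ _ _ P (X k) (X l)
    _ (measurableI _ _ (mXA i mC) (mXA j mD))) => // C' D' mC' mD'.
  by rewrite setIC muleC; exact: indep4.
have distW i' j' : i' != j' ->
    \int[distribution P (W i' j')]_z (absd z.1 z.2)%:E = (2 * s / Num.sqrt pi)%:E.
  move=> ij'; rewrite ge0_integral_distribution//=; last 2 first.
  - exact/measurable_EFinP.
  - by move=> z; rewrite lee_fin.
  exact: integral_iid_dist.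
have scale c i' j' : i' != j' -> (0 <= c)%R ->
    \int[distribution P (W i' j')]_z (c * absd z.1 z.2)%:E =
    (c * (2 * s / Num.sqrt pi))%:E.
  move=> ij' c0; under eq_integral do rewrite EFinM.
  rewrite ge0_integralZl//; last 2 first.
  - exact/measurable_EFinP.
  - by move=> v _; rewrite lee_fin.
  by rewrite distW// EFinM.
under eq_integral => z _ do rewrite scale// mulrC.
by rewrite scale// divr_ge0 ?sqrtr_ge0// mulr_ge0// ltW.
Qed.

End iid_normal_moments.

(** * Calculus of finite means *)

Section has_mean.
Context {R : realType} {d : measure_display} {Omega : measurableType d}
  (P : probability Omega R).
Implicit Types (f g : Omega -> R) (a b c : R).

(** Bundling integrability with a real value lets sums and multiples be formed without finiteness
    side conditions. *)
Definition has_mean f c :=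
  P.-integrable [set: Omega] (EFin \o f) /\ (\int[P]_w (f w)%:E = c%:E)%E.

Lemma ge0_has_mean f c : measurable_fun [set: Omega] f -> (forall w, 0 <= f w) ->
  (\int[P]_w (f w)%:E = c%:E)%E -> has_mean f c.
Proof.
move=> mf f0 fc; split=> //; apply/integrableP; split.
  exact/measurable_EFinP.
under eq_integral do rewrite gee0_abs ?lee_fin//.
by rewrite fc ltry.
Qed.

Lemma has_mean_cst c : has_mean (cst c) c.
Proof.
split; first exact: finite_measure_integrable_cst.
by have := expectation_cst P c; rewrite unlock.
Qed.

Lemma has_meanD f g a b : has_mean f a -> has_mean g b ->
  has_mean (fun w => f w + g w) (a + b).
Proof.
move=> [If Ef] [Ig Eg]; split.
  by rewrite (_ : _ \o _ = (EFin \o f) \+ (EFin \o g))%E//; exact: integrableD.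
by rewrite integralD_EFin// Ef Eg.
Qed.

Lemma has_meanZ f a c : has_mean f a -> has_mean (fun w => c * f w) (c * a).
Proof.
move=> [If Ef]; split.
  rewrite (_ : _ \o _ = (fun w => c%:E * (EFin \o f) w))%E//.
  exact: integrableZl.
by under eq_integral do rewrite EFinM; rewrite integralZl// Ef.
Qed.

Lemma has_mean_sum (I : Type) (r : seq I) (Q : pred I) (F : I -> Omega -> R)
    (c : I -> R) : (forall i, Q i -> has_mean (F i) (c i)) ->
  has_mean (fun w => \sum_(i <- r | Q i) F i w) (\sum_(i <- r | Q i) c i).
Proof.
move=> FQ; elim: r => [|i r IH].
  under eq_fun do rewrite big_nil.
  by rewrite big_nil; exact: has_mean_cst.
under eq_fun do rewrite big_cons.
rewrite big_cons; case: ifPn => // Qi; apply: has_meanD => //; exact: FQ.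
Qed.

Lemma has_mean_expectation f c : has_mean f c -> 'E_P[f]%E = c%:E.
Proof. by move=> [_ fc]; rewrite unlock. Qed.

Lemma has_mean_variance f a q : has_mean f a -> has_mean (fun w => f w * f w) q ->
  'V_P[f]%E = (q - a ^+ 2)%:E.
Proof.
move=> fa fq; rewrite /variance unlock (has_mean_expectation fa)/=.
have := has_meanD (has_meanD fq (has_meanZ (- (2 * a)) fa)) (has_mean_cst (a ^+ 2)).
rewrite (_ : q + - (2 * a) * a + a ^+ 2 = q - a ^+ 2); last by ring.
move=> /has_mean_expectation <-; congr ('E_P[_])%E; apply/funext => w /=.
by rewrite !fctE /=; ring.
Qed.

End has_mean.

Section iid_moments.
Context {R : realType} {d : measure_display} {Omega : measurableType d}
  (P : probability Omega R) (n : nat) (X : 'I_n -> {RV P >-> R}) (m s : R).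
Hypotheses (s_gt0 : 0 < s) (X_iid : iid_normal X m s).
Implicit Types (i j k l : 'I_n).

Local Notation D i j := (fun w => `|X i w - X j w|).

Let measurable_D i j : measurable_fun [set: Omega] (D i j).
Proof. by apply: measurableT_comp => //; exact: measurable_funB. Qed.

Definition normal_dist_mean : R := 2 * s / Num.sqrt pi.
Definition normal_dist_var : R := 2 * s ^+ 2 - normal_dist_mean ^+ 2.
Definition normal_dist_cov : R :=
  s ^+ 2 * (3^-1 + 2 * Num.sqrt 3 / pi) - normal_dist_mean ^+ 2.

Local Notation m1 := normal_dist_mean.
Local Notation v0 := normal_dist_var.
Local Notation v1 := normal_dist_cov.

(* The pairs {i, j} and {k, l} have overlap1 equal to the number of common indices
   and overlap2 equal to 1 exactly when they coincide; the covariance of the two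
   distances is thus v1 * overlap1 + (v0 - 2 * v1) * overlap2. *)
Definition overlap1 i j k l : nat := (i == k) + (i == l) + (j == k) + (j == l).
Definition overlap2 i j k l : nat :=
  ((i == k) && (j == l)) + ((i == l) && (j == k)).

Lemma has_mean_iid_dist i j : i != j -> has_mean P (D i j) m1.
Proof.
move=> ij; apply: ge0_has_mean; [exact: measurable_D|by move=> w /=|].
exact: (integral_iid_dist s_gt0 X_iid).
Qed.

Lemma has_mean_iid_distM i j k l : i != j -> k != l ->
  has_mean P (fun w => D i j w * D k l w)
    (m1 ^+ 2 + v1 * (overlap1 i j k l)%:R + (v0 - 2 * v1) * (overlap2 i j k l)%:R).
Proof.
move=> ij kl; apply: ge0_has_mean; first exact: measurable_funM.
  by move=> w; rewrite mulr_ge0.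
have shared a b c : a != b -> a != c -> b != c -> (\int[P]_w (D a c w * D b c w)%:E =
    (m1 ^+ 2 + v1)%:E)%E.
  move=> ab ac bc; rewrite (integral_iid_dist_shared s_gt0 X_iid).
    by rewrite [in RHS]addrC subrK.
  by rewrite /= !inE negb_or ab ac bc.
have same a b : a != b -> (\int[P]_w (D a b w * D a b w)%:E = (m1 ^+ 2 + v0)%:E)%E.
  by move=> ab; rewrite (integral_iid_sqr_dist s_gt0 X_iid)// [in RHS]addrC subrK.
have DC a b w : D a b w = D b a w by rewrite /= distrC.
rewrite /overlap1 /overlap2.
(* Seven coincidence patterns are compatible with [i != j] and [k != l]: two where the pairs
   coincide, four with one shared index, one disjoint. In the shared cases [distrC] moves the common
   index to second position. *)
have [ik|ik] := eqVneq i k; [|have [il|il] := eqVneq i l];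
  have [jk|jk] := eqVneq j k; have [jl|jl] := eqVneq j l; subst=> //=;
  rewrite ?eqxx in ij kl *; try by [].
- rewrite (negbTE kl).
  rewrite [X in v1 * X%:R](_ : _ = 2%N)// [X in (v0 - _) * X%:R](_ : _ = 1%N)//.
  by rewrite same//; congr EFin; ring.
- rewrite (negbTE kl).
  rewrite [X in v1 * X%:R](_ : _ = 1%N)// [X in (v0 - _) * X%:R](_ : _ = 0%N)//.
  under eq_integral do rewrite [X in X * _]distrC [X in _ * X]distrC.
  by rewrite shared; [rewrite mulr1 mulr0 addr0|rewrite // eq_sym..].
- rewrite [X in v1 * X%:R](_ : _ = 2%N)// [X in (v0 - _) * X%:R](_ : _ = 1%N)//.
  under eq_integral do rewrite distrC.
  by rewrite same//; congr EFin; ring.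
- rewrite [X in v1 * X%:R](_ : _ = 1%N)// [X in (v0 - _) * X%:R](_ : _ = 0%N)//.
  under eq_integral do rewrite distrC.
  by rewrite shared; [rewrite mulr1 mulr0 addr0|rewrite // eq_sym..].
- rewrite [X in v1 * X%:R](_ : _ = 1%N)// [X in (v0 - _) * X%:R](_ : _ = 0%N)//.
  under eq_integral do rewrite [X in _ * X]distrC.
  by rewrite shared; [rewrite mulr1 mulr0 addr0|rewrite // eq_sym..].
- rewrite [X in v1 * X%:R](_ : _ = 1%N)// [X in (v0 - _) * X%:R](_ : _ = 0%N)//.
  by rewrite shared; [rewrite mulr1 mulr0 addr0|rewrite // eq_sym..].
- rewrite [X in v1 * X%:R](_ : _ = 0%N)// [X in (v0 - _) * X%:R](_ : _ = 0%N)//.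
  rewrite !mulr0 !addr0; apply: (integral_iid_dist_disjoint s_gt0 X_iid).
  by rewrite /= !inE !negb_or ij ik il jk jl kl.
Qed.

End iid_moments.

(** * Averaging over the random permutation *)

Section permutation_mean.
Context {R : realType} {d : measure_display} {Omega : measurableType d}
  (P : probability Omega R) (n : nat) (X : 'I_n -> {RV P >-> R})
  (Pi : Omega -> 'S_n).
Hypotheses (Pi_unif : uniform_permutation P Pi)
  (Pi_indep : permutation_independent X Pi).

Lemma measurable_sample : measurable_fun [set: Omega] (sample X).
Proof.
apply/measurable_fun_tnthP => i.
by rewrite (_ : _ \o _ = X i)//; apply/funext => w /=; rewrite tnth_mktuple.
Qed.

Let sampleM : {mfun Omega >-> n.-tuple R} :=
  HB.pack (sample X) (isMeasurableFun.Build _ _ _ _ _ measurable_sample).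

(** The variable is cut along the finitely many events [Pi = s], each independent of the sample and
    of probability [1 / n!]; no joint law of sample and permutation has to be formed. *)
Lemma ge0_has_mean_permutation (f : n.-tuple R -> 'S_n -> R) (c : 'S_n -> R) :
  (forall s, measurable_fun [set: n.-tuple R] (f ^~ s)) ->
  (forall x s, 0 <= f x s) ->
  (forall s, has_mean P (fun w => f (sample X w) s) (c s)) ->
  has_mean P (fun w => f (sample X w) (Pi w)) ((n`!)%:R^-1 * \sum_s c s).
Proof.
move=> mf f0 fc.
have mE s : measurable (Pi @^-1` [set s]) := (Pi_unif s).1.
have -> : (fun w => f (sample X w) (Pi w)) =
    (fun w => \sum_s \1_(Pi @^-1` [set s]) w * f (sample X w) s).
  apply/funext => w; rewrite (bigD1 (Pi w))//= big1 => [|s sPi].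
    by rewrite indicE mem_set//= mul1r addr0.
  by rewrite indicE memNset ?mul0r// => /= /esym/eqP; rewrite (negbTE sPi).
rewrite mulr_sumr; apply: has_mean_sum => s _; apply: ge0_has_mean.
- apply: measurable_funM; first exact: measurable_indic.
  exact: (measurableT_comp (mf s) measurable_sample).
- by move=> w; rewrite mulr_ge0.
transitivity (\int[P]_(w in Pi @^-1` [set s]) (EFin \o f ^~ s) (sampleM w))%E.
  rewrite [RHS]integral_mkcond; apply: eq_integral => w _.
  by rewrite patchE indicE; case: ifP => _; rewrite ?mul1r ?mul0r.
rewrite ge0_integral_indep_event//.
- by rewrite (Pi_unif s).2 EFinM -(fc s).2.
- by move=> A mA; exact: Pi_indep.
- exact/measurable_EFinP.
- by move=> z; rewrite lee_fin.
Qed.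

Lemma has_mean_uniform_permutation (g : 'S_n -> R) : (forall s, 0 <= g s) ->
  has_mean P (fun w => g (Pi w)) ((n`!)%:R^-1 * \sum_s g s).
Proof.
move=> g0; apply: (@ge0_has_mean_permutation (fun _ => g) g) => //.
by move=> s; exact: has_mean_cst.
Qed.

End permutation_mean.

(** * First and second moments of sums of distances *)

Section iid_sums.
Context {R : realType} {d : measure_display} {Omega : measurableType d}
  (P : probability Omega R) (n : nat) (X : 'I_n -> {RV P >-> R}) (m s : R).
Hypotheses (s_gt0 : 0 < s) (X_iid : iid_normal X m s).
Local Notation m1 := (normal_dist_mean s).
Local Notation v0 := (normal_dist_var s).
Local Notation v1 := (normal_dist_cov s).
Variables (I : finType) (Q : pred I) (a b : I -> 'I_n).
Hypothesis ab : forall t, Q t -> a t != b t.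

Let S w := \sum_(t | Q t) `|X (a t) w - X (b t) w|.

Lemma has_mean_iid_sum : has_mean P S (#|Q|%:R * m1).
Proof.
rewrite mulr_natl -sumr_const; apply: has_mean_sum => t Qt.
exact: (has_mean_iid_dist s_gt0 X_iid (ab Qt)).
Qed.

(** Expanding the square turns the second moment into two overlap counts. The family of pairs is
    arbitrary, so that the result serves both the path and the set of all ordered pairs. *)
Lemma has_mean_iid_sqr_sum : has_mean P (fun w => S w * S w)
  (#|Q|%:R ^+ 2 * m1 ^+ 2
   + v1 * (\sum_(t | Q t) \sum_(u | Q u) overlap1 (a t) (b t) (a u) (b u))%:R
   + (v0 - 2 * v1) *
     (\sum_(t | Q t) \sum_(u | Q u) overlap2 (a t) (b t) (a u) (b u))%:R).
Proof.
rewrite (_ : (fun w => _) = fun w => \sum_(t | Q t) \sum_(u | Q u)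
   (`|X (a t) w - X (b t) w| * `|X (a u) w - X (b u) w|)); last first.
  by apply/funext => w; rewrite /S mulr_suml; under eq_bigr do rewrite mulr_sumr.
rewrite (_ : _ + _ = \sum_(t | Q t) \sum_(u | Q u)
   (m1 ^+ 2 + v1 * (overlap1 (a t) (b t) (a u) (b u))%:R
   + (v0 - 2 * v1) * (overlap2 (a t) (b t) (a u) (b u))%:R)).
  apply: has_mean_sum => t Qt; apply: has_mean_sum => u Qu.
  exact: (has_mean_iid_distM s_gt0 X_iid (ab Qt) (ab Qu)).
rewrite !natr_sum !mulr_sumr.
under [RHS]eq_bigr do rewrite !big_split/= sumr_const -!mulr_sumr -!natr_sum.
rewrite !big_split/= sumr_const; congr (_ + _ + _).
by rewrite -mulrnA -[RHS]mulr_natl natrM expr2.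
Qed.

End iid_sums.

(** * Counting overlaps *)

Lemma sum_eq_bool (I : finType) (Q : pred I) (x : I) :
  (\sum_(u | Q u) (x == u) = Q x :> nat)%N.
Proof.
rewrite big_mkcond (bigD1 x)//= eqxx big1 ?addn0; first by case: (Q x).
by move=> u; rewrite eq_sym => /negbTE ->; case: ifP.
Qed.

Section path_overlaps.
Variable k : nat.
Implicit Types t u : 'I_k.+2.

Lemma ordS_gt0 t : (0 < ordS t)%N = (t != ord_max).
Proof.
rewrite /= -val_eqE/=; have := ltn_ord t; rewrite ltnS leq_eqVlt.
case/predU1P => [->|tk]; first by rewrite modnn eqxx.
by rewrite modn_small// ltn_eqF.
Qed.

Lemma card_ord_gt0 : #|[pred t : 'I_k.+2 | (0 < t)%N]| = k.+1.
Proof.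
transitivity #|predC1 (ord0 : 'I_k.+2)|; last by rewrite cardC1 card_ord.
by apply: eq_card => t; rewrite !inE -val_eqE/= lt0n.
Qed.

(** [ordS] wraps the last position round to 0, so exactly one of the [k + 1] positive positions is
    lost. *)
Lemma sum_ordS_gt0 : (\sum_(t : 'I_k.+2 | 0 < t) (0 < ordS t) = k)%N.
Proof.
have : (\sum_(t : 'I_k.+2 | 0 < t) ((0 < ordS t) + (ord_max == t)) = k.+1)%N.
  rewrite -[RHS]card_ord_gt0 -sum1_card; apply: eq_bigr => t _.
  by rewrite ordS_gt0 eq_sym; case: eqP.
by rewrite big_split/= sum_eq_bool/= addn1 => -[].
Qed.

Lemma eq_ord_predr t u : (t == ord_pred u) = (ordS t == u).
Proof. by apply/eqP/eqP => [->|<-]; rewrite (ord_predK, ordSK). Qed.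

(** Injectivity of [s] removes the permutation. Each of the [k + 1] edges shares two endpoints with
    itself, and each of the [k] pairs of consecutive edges, counted in both orders, shares one. *)
Lemma sum_path_overlap1 (s : 'S_k.+2) :
  (\sum_(t < k.+2 | 0 < t) \sum_(u < k.+2 | 0 < u)
     overlap1 (s t) (s (ord_pred t)) (s u) (s (ord_pred u)) =
   2 * k.+1 + 2 * k)%N.
Proof.
have eqs : (\sum_(t < k.+2 | 0 < t) \sum_(u < k.+2 | 0 < u) (t == u) = k.+1)%N.
  rewrite -[RHS]card_ord_gt0 -sum1_card; apply: eq_bigr => t t0.
  by rewrite sum_eq_bool t0.
have eqp : (\sum_(t < k.+2 | 0 < t) \sum_(u < k.+2 | 0 < u) (t == ord_pred u) = k)%N.
  rewrite -[RHS]sum_ordS_gt0; apply: eq_bigr => t t0.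
  by under eq_bigr do rewrite eq_ord_predr; rewrite sum_eq_bool.
rewrite /overlap1; under eq_bigr => t _.
  under eq_bigr => u _ do rewrite !(inj_eq perm_inj)
    (can_eq (@ord_predK _)) [ord_pred t == u]eq_sym.
  rewrite !big_split/=; over.
rewrite !big_split/= [X in (_ + X + _)%N]exchange_big/= !eqs !eqp; lia.
Qed.

Lemma sum_path_overlap2 (s : 'S_k.+2) :
  (\sum_(t < k.+2 | 0 < t) \sum_(u < k.+2 | 0 < u)
     overlap2 (s t) (s (ord_pred t)) (s u) (s (ord_pred u)) = k.+1)%N.
Proof.
rewrite -[RHS]card_ord_gt0 -sum1_card; apply: eq_bigr => t t0.
rewrite -[RHS]/(nat_of_bool true) -[true]t0.
rewrite -(sum_eq_bool (fun u : 'I_k.+2 => 0 < u)%N t).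
apply: eq_bigr => u u0; rewrite /overlap2 !(inj_eq perm_inj).
rewrite (can_eq (@ord_predK _)) andbb -[RHS]addn0; congr (_ + _)%N.
(* An edge cannot be another one reversed: with [t] and [u] positive no predecessor wraps around,
   and [t = u - 1], [u = t - 1] is absurd. *)
case: (t =P ord_pred u) => //= tu; case: (ord_pred t =P u) => //= ut.
have := congr1 val tu; have := congr1 val ut.
rewrite /= => <- e; exfalso; move: t0 u0 e; rewrite -ut /=.
have := ltn_ord t; move: (nat_of_ord t) => x xk x0.
have predE y : (0 < y)%N -> (y < k.+2)%N -> ((y + k.+2).-1 %% k.+2 = y.-1)%N.
  move=> y0 yk; rewrite -subn1 addnC -addnBA// modnDl subn1 modn_small//.
  exact: leq_ltn_trans (leq_pred _) yk.
rewrite predE// => x1; rewrite predE//; last exact: leq_ltn_trans (leq_pred _) xk.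
lia.
Qed.

End path_overlaps.

Section pair_overlaps.
Variable n : nat.
Local Notation Q := [pred p : 'I_n * 'I_n | p.1 != p.2].

Lemma sum_neq1 (i : 'I_n) : (\sum_(j | i != j) 1 = n.-1)%N.
Proof.
rewrite sum1_card; transitivity #|predC1 i|; last by rewrite cardC1 card_ord.
by apply: eq_card => j; rewrite !inE eq_sym.
Qed.

Lemma card_neq_pairs : #|Q| = (n * n.-1)%N.
Proof.
rewrite -sum1_card -(pair_big_dep xpredT (fun i j => i != j) (fun=> fun=> 1%N))/=.
by under eq_bigr do rewrite sum_neq1; rewrite sum_nat_const card_ord.
Qed.

(** For fixed [p], each of the four equalities in [overlap1] holds for [n - 1] ordered pairs [q]. *)
Lemma sum_pair_overlap1 :
  (\sum_(p | Q p) \sum_(q | Q q) overlap1 p.1 p.2 q.1 q.2 =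
   4 * n.-1 * (n * n.-1))%N.
Proof.
have fst_eq (i : 'I_n) : (\sum_(q | Q q) (i == q.1) = n.-1)%N.
  rewrite -(pair_big_dep xpredT (fun i j => i != j) (fun k l => i == k : nat))/=.
  rewrite (bigD1 i)//= [X in (_ + X)%N]big1 ?addn0 ?eqxx ?sum_neq1// => j.
  by rewrite eq_sym => /negbTE ->; rewrite big1.
have snd_eq (i : 'I_n) : (\sum_(q | Q q) (i == q.2) = n.-1)%N.
  rewrite -[RHS](fst_eq i) (reindex_inj (inv_inj (@swap_pairK _ _)))/=.
  by apply: eq_bigl => q; rewrite /= eq_sym.
rewrite -card_neq_pairs mulnC -sum_nat_const; apply: eq_bigr => p _.
by rewrite !big_split/= !fst_eq !snd_eq; lia.
Qed.

(** For fixed [p], only [p] itself and its swap contribute. *)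
Lemma sum_pair_overlap2 :
  (\sum_(p | Q p) \sum_(q | Q q) overlap2 p.1 p.2 q.1 q.2 = 2 * (n * n.-1))%N.
Proof.
rewrite -card_neq_pairs mulnC -sum_nat_const; apply: eq_bigr => p /= Qp.
rewrite big_split/= (eq_bigr (fun q => p == q : nat)) => [|q _]; last first.
  by rewrite -pair_eqE.
rewrite sum_eq_bool (eq_bigr (fun q => (p.2, p.1) == q : nat)) => [|q _]; last first.
  by rewrite -pair_eqE/= andbC.
by rewrite sum_eq_bool/= Qp eq_sym Qp.
Qed.

End pair_overlaps.

(** * Images of a fixed pair under all permutations *)

Section permutation_average.
Context {R : comNzRingType} (n : nat) (f : 'I_n -> 'I_n -> R).

Lemma perm_2transitive (t u t' u' : 'I_n) : t != u -> t' != u' ->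
  exists p : 'S_n, p t = t' /\ p u = u'.
Proof.
move=> tu tu'; pose p := tperm t t'.
(* The second transposition moves [p u] to [u'] and leaves [t'] alone, since [t'] differs from [u']
   and, by injectivity of [p], from [p u]. *)
exists (p * tperm (p u) u')%g; rewrite !permM tpermL; split; last exact: tpermL.
rewrite tpermD// 1?eq_sym//; apply: contra_neq tu => e.
by apply: (@perm_inj _ p); rewrite tpermL.
Qed.

(** By 2-transitivity the sum over permutations is the same for every ordered pair of distinct
    positions. Summing over those pairs and exchanging, each [s] merely permutes the pairs. Both
    sides are multiplied out because [R] is only a ring. *)
Lemma sum_perm_pair (t u : 'I_n) : t != u ->
  (n * n.-1)%:R * (\sum_(s : 'S_n) f (s t) (s u)) =
  (n`!)%:R * (\sum_(p : 'I_n * 'I_n | p.1 != p.2) f p.1 p.2).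
Proof.
move=> tu.
have same p : p.1 != p.2 ->
    \sum_(s : 'S_n) f (s p.1) (s p.2) = \sum_(s : 'S_n) f (s t) (s u).
  move=> p12; have [q [<- <-]] := perm_2transitive tu p12.
  rewrite [RHS](reindex_inj (mulgI q)); apply: eq_bigr => s _.
  by rewrite !permM.
transitivity (\sum_(p : 'I_n * 'I_n | p.1 != p.2) \sum_(s : 'S_n) f (s p.1) (s p.2)).
  rewrite (eq_bigr _ same) sumr_const -(card_neq_pairs n) mulr_natl.
  by congr (_ *+ _); apply: eq_card => p; rewrite !inE.
rewrite exchange_big/= -(card_Sn n) mulr_natl -sumr_const; apply: eq_bigr => s _.
have hinj : injective (fun p : 'I_n * 'I_n => (s p.1, s p.2)).
  by move=> [a b] [a' b'] /= [/perm_inj -> /perm_inj ->].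
rewrite [RHS](reindex_inj hinj)/=; apply: eq_bigl => p.
by rewrite (inj_eq perm_inj).
Qed.

End permutation_average.

(** * Bounds on pi *)

Section pi_bounds.
Context {R : realType}.
Implicit Types (f g : R -> R) (x : R).

Lemma ge0_derive_ge0 f g : (forall x : R, is_derive x 1 f (g x)) -> f 0 = 0 ->
  (forall x, 0 <= x -> 0 <= g x) -> forall x, 0 <= x -> 0 <= f x.
Proof.
move=> df f0 g0 x x0.
have cf : {within `[0, x], continuous f}.
  apply: continuous_subspaceT => y; apply: differentiable_continuous.
  exact/derivable1_diffP.
have [c] := MVT_segment x0 (fun y _ => df y) cf.
rewrite in_itv/= f0 !subr0 => /andP[c0 _] ->.
by rewrite mulr_ge0// g0.
Qed.

(** The factorial makes each monomial the derivative of the next, so Taylor polynomials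
    differentiate to Taylor polynomials. *)
Let mono (n : nat) (x : R) : R := x ^+ n / n`!%:R.

Let is_derive_mono n (x : R) : is_derive x 1 (mono n.+1) (mono n x).
Proof.
have f0 : (n`!)%:R != 0 :> R by rewrite pnatr_eq0 -lt0n fact_gt0.
have n0 : n.+1%:R != 0 :> R by rewrite pnatr_eq0.
have dX := @is_deriveX _ _ id n.+1 x 1 1 (is_derive_id x 1).
have dZ := @is_deriveZ _ _ _ _ ((n.+1)`!%:R)^-1 x 1 _ dX.
rewrite (_ : mono n.+1 = (n.+1)`!%:R^-1 \*: (id ^+ n.+1))%R; last first.
  by apply/funext => y; rewrite /mono exprfctE/= mulrC.
apply: (@is_derive_eq _ _ _ _ _ _ _ _ dZ).
rewrite /mono /GRing.scale/= factS natrM.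
by move: f0 n0; move: (n`!%:R) (n.+1%:R) => a b a0 b0; field; rewrite a0.
Qed.
Local Existing Instance is_derive_mono.

Let mono1 x : mono 0 x = 1. Proof. by rewrite /mono expr0 divr1. Qed.

Let mono0 n : mono n.+1 0 = 0.
Proof. by rewrite /mono expr0n mul0r. Qed.

(** Starting from [cos <= 1], each Taylor bound below integrates the preceding one from 0,
    alternating between sine and cosine. *)
Let taylor_step (f g h : R -> R) : (forall x : R, is_derive x 1 f (g x - h x)) ->
  f 0 = 0 -> (forall x, 0 <= x -> h x <= g x) -> forall x, 0 <= x -> 0 <= f x.
Proof.
move=> df f0 gh; apply: ge0_derive_ge0 df f0 _ => x x0.
by rewrite subr_ge0 gh.
Qed.

Let sin_taylor1 x : 0 <= x -> sin x <= mono 1 x.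
Proof.
move=> x0; rewrite -subr_ge0.
have d (y : R) : is_derive y 1 (fun x => mono 1 x - sin x) ((1) - (cos y)).
  by apply: is_derive_eq; rewrite ?mono1; ring.
apply: (taylor_step (g := fun x => 1) (h := fun x => cos x) d _ _ x0).
  by rewrite sin0 !mono0; ring.
by move=> y _; exact: cos_le1.
Qed.

Let cos_taylor2 x : 0 <= x -> 1 - mono 2 x <= cos x.
Proof.
move=> x0; rewrite -subr_ge0.
have d (y : R) : is_derive y 1
    (fun x => cos x - (1 - mono 2 x))
    ((mono 1 y) - (sin y)).
  by apply: is_derive_eq; rewrite ?mono1; ring.
apply: (taylor_step (g := fun x => mono 1 x) (h := fun x => sin x) d _ _ x0).
  by rewrite cos0 !mono0; ring.
exact: sin_taylor1.
Qed.

Let sin_taylor3 x : 0 <= x -> mono 1 x - mono 3 x <= sin x.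
Proof.
move=> x0; rewrite -subr_ge0.
have d (y : R) : is_derive y 1
    (fun x => sin x - (mono 1 x - mono 3 x))
    ((cos y) - (1 - mono 2 y)).
  by apply: is_derive_eq; rewrite ?mono1; ring.
apply: (taylor_step (g := fun x => cos x)
  (h := fun x => 1 - mono 2 x) d _ _ x0).
  by rewrite sin0 !mono0; ring.
exact: cos_taylor2.
Qed.

Let cos_taylor4 x : 0 <= x -> cos x <= 1 - mono 2 x + mono 4 x.
Proof.
move=> x0; rewrite -subr_ge0.
have d (y : R) : is_derive y 1
    (fun x => 1 - mono 2 x + mono 4 x - cos x)
    ((sin y) - (mono 1 y - mono 3 y)).
  by apply: is_derive_eq; rewrite ?mono1; ring.
apply: (taylor_step (g := fun x => sin x)
  (h := fun x => mono 1 x - mono 3 x) d _ _ x0).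
  by rewrite cos0 !mono0; ring.
exact: sin_taylor3.
Qed.

Let sin_taylor5 x : 0 <= x -> sin x <= mono 1 x - mono 3 x + mono 5 x.
Proof.
move=> x0; rewrite -subr_ge0.
have d (y : R) : is_derive y 1
    (fun x => mono 1 x - mono 3 x + mono 5 x - sin x)
    ((1 - mono 2 y + mono 4 y) - (cos y)).
  by apply: is_derive_eq; rewrite ?mono1; ring.
apply: (taylor_step (g := fun x => 1 - mono 2 x + mono 4 x)
  (h := fun x => cos x) d _ _ x0).
  by rewrite sin0 !mono0; ring.
exact: cos_taylor4.
Qed.

Let cos_taylor6 x : 0 <= x -> 1 - mono 2 x + mono 4 x - mono 6 x <= cos x.
Proof.
move=> x0; rewrite -subr_ge0.
have d (y : R) : is_derive y 1
    (fun x => cos x - (1 - mono 2 x + mono 4 x - mono 6 x))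
    ((mono 1 y - mono 3 y + mono 5 y) - (sin y)).
  by apply: is_derive_eq; rewrite ?mono1; ring.
apply: (taylor_step (g := fun x => mono 1 x - mono 3 x + mono 5 x)
  (h := fun x => sin x) d _ _ x0).
  by rewrite cos0 !mono0; ring.
exact: sin_taylor5.
Qed.

Let sin_taylor7 x : 0 <= x -> mono 1 x - mono 3 x + mono 5 x - mono 7 x <= sin x.
Proof.
move=> x0; rewrite -subr_ge0.
have d (y : R) : is_derive y 1
    (fun x => sin x - (mono 1 x - mono 3 x + mono 5 x - mono 7 x))
    ((cos y) - (1 - mono 2 y + mono 4 y - mono 6 y)).
  by apply: is_derive_eq; rewrite ?mono1; ring.
apply: (taylor_step (g := fun x => cos x)
  (h := fun x => 1 - mono 2 x + mono 4 x - mono 6 x) d _ _ x0).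
  by rewrite sin0 !mono0; ring.
exact: cos_taylor6.
Qed.

Lemma sin_le_taylor5 x : 0 <= x -> sin x <= x - x ^+ 3 / 6 + x ^+ 5 / 120.
Proof. by move=> /sin_taylor5; rewrite /mono divr1. Qed.

Lemma sin_ge_taylor7 x : 0 <= x ->
  x - x ^+ 3 / 6 + x ^+ 5 / 120 - x ^+ 7 / 5040 <= sin x.
Proof. by move=> /sin_taylor7; rewrite /mono divr1. Qed.

(* y = sin (pi / 6) satisfies 3 y - 4 y^3 = sin (pi / 2) = 1. *)
Lemma sin_pi6 : sin (pi / 6) = 2^-1 :> R.
Proof.
set p := pi / 6.
have p3 : p *+ 2 + p = pi / 2.
  by rewrite /p; move: pi => q; field.
have s1 : sin (p *+ 2 + p) = 1 by rewrite p3 sin_pihalf.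
have p0 : 0 < p by rewrite divr_gt0// pi_gt0.
have sp : 0 < sin p.
  apply: sin_gt0_pi; rewrite p0/= /p ltr_pdivrMr// ltr_pMr ?pi_gt0//.
  by rewrite ltr1n.
move: s1; rewrite sinD mulr2n sinD cosD.
have c2 := cos2sin2 p; move: sp c2; set y := sin p; set c := cos p => y0 c2.
move=> E.
(* This factors [1 - 3 * y + 4 * y ^ 3]; positivity of [y] excludes the root -1. *)
have {}E : (y + 1) * (2 * y - 1) ^+ 2 = 0.
  have : (y * c + c * y) * c + (c * c - y * y) * y = 3 * y - 4 * y ^+ 3.
    by transitivity (3 * y * c ^+ 2 - y ^+ 3); [ring|rewrite c2; ring].
  by rewrite E => e; transitivity (1 - (3 * y - 4 * y ^+ 3)); [ring|rewrite -e; ring].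
move/eqP: E; rewrite mulf_eq0 gt_eqF ?addr_gt0//= expf_eq0/= subr_eq0 => /eqP e.
by apply: (@mulfI _ 2) => //; rewrite e divff.
Qed.

(** Sine increases on [[- pi / 2, pi / 2]] and equals [1 / 2] at [pi / 6], so each bound is a Taylor
    estimate of sine at a sixth of the rational number. *)
Lemma pi_bounds : 3141 / 1000 < (pi : R) < 377 / 120.
Proof.
have h1 := @pihalf_ge1 R.
have p0 := @pi_gt0 R.
have pin (x : R) : 0 <= x <= 1 -> x \in `[- (pi / 2), pi / 2].
  move=> /andP[x0 x1]; rewrite in_itv/=; apply/andP; split; last exact: le_trans h1.
  by apply: le_trans x0; rewrite oppr_le0 divr_ge0// ltW.
have pin6 : pi / 6 \in `[- (pi / 2), (pi / 2 : R)].
  rewrite in_itv/=; apply/andP; split.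
    by apply: (@le_trans _ _ 0); rewrite ?oppr_le0 ?divr_ge0// ltW.
  by rewrite ler_pM2l// lef_pV2 ?posrE// ler_nat.
apply/andP; split; rewrite -(ltr_pM2r (_ : 0 < 6^-1)) ?invr_gt0//.
- rewrite -ltr_sin//; last by apply: pin; lra.
  rewrite sin_pi6; apply: le_lt_trans (sin_le_taylor5 _) _; lra.
- rewrite -ltr_sin//; last by apply: pin; lra.
  rewrite sin_pi6; apply: lt_le_trans (sin_ge_taylor7 _); lra.
Qed.

Lemma adjacent_fraction_approx :
  `|(pi + 3 - 3 * Num.sqrt 3) / (2 * pi + 3 * Num.sqrt 3 - 9)
      - 3813 / 10 ^+ 4| <= 2^-1 / 10 ^+ 4 :> R.
Proof.
have /andP[] := pi_bounds; move: pi => p pl pu.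
have s3 : Num.sqrt 3 ^+ 2 = 3 :> R by rewrite sqr_sqrtr.
have s30 : 0 <= Num.sqrt 3 :> R by rewrite sqrtr_ge0.
move: s3 s30; set w := Num.sqrt 3 => s3 s30.
(* These are consecutive convergents of the continued fraction of [sqrt 3]. Once the denominator is
   cleared, the goals are linear in [p] and [w]. *)
have wl : 989 / 571 < w by nra.
have wu : w < 1351 / 780 by nra.
have den : 0 < 2 * p + 3 * w - 9 by lra.
rewrite ler_norml; apply/andP; split.
  by rewrite lerBrDr ler_pdivlMr//; lra.
by rewrite lerBlDr ler_pdivrMr//; lra.
Qed.

End pi_bounds.

(** * The two variances and their ratio *)

Section variances.
Context {R : realType} {d : measure_display} {Omega : measurableType d}
  (P : probability Omega R) (k : nat).
Local Notation n := k.+2.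
Context (X : 'I_n -> {RV P >-> R}) (Pi : Omega -> 'S_n) (m s : R).
Hypotheses (s_gt0 : 0 < s) (X_iid : iid_normal X m s)
  (Pi_unif : uniform_permutation P Pi) (X_Pi_indep : permutation_independent X Pi).
Local Notation m1 := (normal_dist_mean s).
Local Notation v0 := (normal_dist_var s).
Local Notation v1 := (normal_dist_cov s).
Local Notation c := (@d2 R)^-1.
Local Notation N := (k.+1%:R : R).

Let path_sqr : R := N ^+ 2 * m1 ^+ 2 + v1 * (2 * k.+1 + 2 * k)%:R
  + (v0 - 2 * v1) * N.

Let pair_sqr : R := (n * k.+1)%:R ^+ 2 * m1 ^+ 2
  + v1 * (4 * k.+1 * (n * k.+1))%:R + (v0 - 2 * v1) * (2 * (n * k.+1))%:R.

Let c_ge0 : 0 <= c. Proof. by rewrite invr_ge0 divr_ge0// sqrtr_ge0. Qed.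

Let Tstat_ge0 (x : n.-tuple R) t : 0 <= Tstat x t.
Proof.
rewrite /Tstat mulr_ge0// mulr_ge0 ?invr_ge0//.
by apply: sumr_ge0 => i _; exact: normr_ge0.
Qed.

Let measurable_Tstat (t : 'S_n) :
  measurable_fun [set: n.-tuple R] (fun x => Tstat x t).
Proof.
apply: measurable_funM => //; apply: measurable_funM => //.
under eq_fun do rewrite big_mkcond.
apply: measurable_sum => i; case: (0 < i)%N => //.
apply: measurableT_comp => //.
by apply: measurable_funB; exact: measurable_tnth.
Qed.

Let TstatE w t : Tstat (sample X w) t = c * N^-1 *
  \sum_(u < n | (0 < u)%N) `|X (t u) w - X (t (ord_pred u)) w|.
Proof.
rewrite /Tstat mulrA; congr (_ * _); apply: eq_bigr => u _.
by rewrite !tnth_mktuple.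
Qed.

Let ord_pred_neq (t : 'S_n) (u : 'I_n) : (0 < u)%N -> t u != t (ord_pred u).
Proof.
move=> u0; rewrite (inj_eq perm_inj) eq_ord_predr -val_eqE/=.
have := ltn_ord u; rewrite ltnS leq_eqVlt => /predU1P[->|uk].
  by rewrite modnn.
by rewrite modn_small// gtn_eqF.
Qed.

Let has_mean_Tstat t : has_mean P (fun w => Tstat (sample X w) t) (c * m1).
Proof.
rewrite (_ : c * m1 = c * N^-1 * (#|[pred u : 'I_n | (0 < u)%N]|%:R * m1)); last first.
  by rewrite card_ord_gt0 -mulrA mulKf// pnatr_eq0.
under eq_fun do rewrite TstatE.
by apply: has_meanZ; exact: (has_mean_iid_sum s_gt0 X_iid (ord_pred_neq t)).
Qed.

Let has_mean_sqr_Tstat t :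
  has_mean P (fun w => Tstat (sample X w) t * Tstat (sample X w) t)
    ((c * N^-1) ^+ 2 * path_sqr).
Proof.
have := has_meanZ ((c * N^-1) ^+ 2)
  (has_mean_iid_sqr_sum s_gt0 X_iid (ord_pred_neq t)).
rewrite card_ord_gt0 sum_path_overlap1 sum_path_overlap2.
by under eq_fun do rewrite expr2 mulrACA -TstatE.
Qed.

Let avg (a : R) : (n`!)%:R^-1 * (\sum_(t : 'S_n) a) = a.
Proof.
by rewrite sumr_const card_Sn -[a *+ _]mulr_natl mulKf// pnatr_eq0 -lt0n fact_gt0.
Qed.

Lemma variance_Tstat : 'V_P[fun w => Tstat (sample X w) (Pi w)]%E =
  ((c * N^-1) ^+ 2 * path_sqr - (c * m1) ^+ 2)%:E.
Proof.
apply: has_mean_variance.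
(* The moments for a fixed permutation do not depend on it; [avg] rewrites each as an average over
   permutations. *)
- rewrite -[c * m1]avg.
  exact: (ge0_has_mean_permutation Pi_unif X_Pi_indep measurable_Tstat).
- rewrite -[X in has_mean _ _ X]avg.
  apply: (ge0_has_mean_permutation Pi_unif X_Pi_indep
    (f := fun x t => Tstat x t * Tstat x t)) => //.
  + by move=> t; apply: measurable_funM; exact: measurable_Tstat.
  + by move=> x t; rewrite mulr_ge0.
Qed.

Lemma cond_varE (x : n.-tuple R) : cond_var P Pi x =
  (n`!)%:R^-1 * (\sum_t Tstat x t * Tstat x t)
  - ((n`!)%:R^-1 * (\sum_t Tstat x t)) ^+ 2.
Proof.
rewrite /cond_var (has_mean_variance (a := (n`!)%:R^-1 * (\sum_t Tstat x t))
  (q := (n`!)%:R^-1 * (\sum_t Tstat x t * Tstat x t)))//.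
- exact: (has_mean_uniform_permutation Pi_unif X_Pi_indep).
- apply: (has_mean_uniform_permutation Pi_unif X_Pi_indep
    (g := fun t => Tstat x t * Tstat x t)) => t.
  by rewrite mulr_ge0.
Qed.

(** This is the conditional mean [G]: by [sum_perm_pair] each of the [n - 1] consecutive pairs of
    positions contributes the average over all ordered pairs of distinct entries. *)
Lemma mean_Tstat_perm (x : n.-tuple R) :
  (n`!)%:R^-1 * (\sum_(t : 'S_n) Tstat x t) = c * (n * k.+1)%:R^-1 *
    \sum_(p : 'I_n * 'I_n | p.1 != p.2) `|tnth x p.1 - tnth x p.2|.
Proof.
set G := (X in _ = _ * X).
have nf0 : (n`!)%:R != 0 :> R by rewrite pnatr_eq0 -lt0n fact_gt0.
have nN0 : (n * k.+1)%:R != 0 :> R by rewrite pnatr_eq0.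
under eq_bigr do rewrite /Tstat mulrA.
rewrite -mulr_sumr exchange_big/=.
rewrite (eq_bigr (fun=> (n`!)%:R / (n * k.+1)%:R * G)) => [|u u0]; last first.
  have uu : u != ord_pred u.
    by have := ord_pred_neq 1%g u0; rewrite !perm1.
  have := sum_perm_pair (fun i j => `|tnth x i - tnth x j|) uu.
  rewrite -/G => e.
  by apply: (mulfI nN0); rewrite e mulrA mulrCA divff// mulr1.
rewrite sumr_const card_ord_gt0 -[(_ * G) *+ _]mulr_natl.
have N0 : N != 0 by rewrite pnatr_eq0.
move: nf0 nN0 N0 G c; move: (n`!%:R : R) ((n * k.+1)%:R : R) (k.+1%:R : R).
by move=> a b e a0 b0 e0 G c; field; rewrite a0 b0 e0.
Qed.

Lemma expectation_cond_var : 'E_P[fun w => cond_var P Pi (sample X w)]%E =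
  ((c * N^-1) ^+ 2 * path_sqr - (c * (n * k.+1)%:R^-1) ^+ 2 * pair_sqr)%:E.
Proof.
apply: has_mean_expectation.
rewrite (_ : (fun w => _) = fun w =>
  (n`!)%:R^-1 * (\sum_t Tstat (sample X w) t * Tstat (sample X w) t) +
  - (c * (n * k.+1)%:R^-1) ^+ 2 *
    ((\sum_(p : 'I_n * 'I_n | p.1 != p.2) `|X p.1 w - X p.2 w|) *
     (\sum_(p : 'I_n * 'I_n | p.1 != p.2) `|X p.1 w - X p.2 w|))); last first.
  apply/funext => w; rewrite cond_varE mean_Tstat_perm mulNr; congr (_ - _).
  rewrite exprMn -expr2; congr (_ * _ ^+ _).
  by apply: eq_bigr => p _; rewrite !tnth_mktuple.
rewrite -[X in _ + X]mulNr; apply: has_meanD.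
  rewrite -[X in has_mean _ _ X]avg; apply: has_meanZ.
  by apply: has_mean_sum => t _.
apply: has_meanZ.
have := has_mean_iid_sqr_sum s_gt0 X_iid (a := fst) (b := snd)
  (Q := [pred p : 'I_n * 'I_n | p.1 != p.2]) (fun=> id).
by rewrite card_neq_pairs sum_pair_overlap1 sum_pair_overlap2.
Qed.

End variances.

(** * The limit and its closed form *)

Section limit.
Context {R : realType} (s : R).
Hypothesis s_gt0 : 0 < s.
Local Notation m1 := (normal_dist_mean s).
Local Notation v0 := (normal_dist_var s).
Local Notation v1 := (normal_dist_cov s).

Lemma sqr_normal_dist_mean : m1 ^+ 2 = 4 * s ^+ 2 / pi.
Proof.
rewrite /normal_dist_mean expr_div_n sqr_sqrtr ?pi_ge0// exprMn.
by congr (_ * _ / _); ring.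
Qed.

Lemma normal_dist_var_gt0 : 0 < v0.
Proof.
rewrite /normal_dist_var sqr_normal_dist_mean.
have /andP[pl _] := @pi_bounds R; have := @pi_gt0 R; move: (pi : R) pl => p pl p0.
rewrite (_ : _ - _ = s ^+ 2 / p * (2 * p - 4)); last by field; rewrite gt_eqF.
by rewrite mulr_gt0// ?divr_gt0 ?exprn_gt0//; lra.
Qed.

Lemma normal_dist_cov_gt0 : 0 < v1.
Proof.
rewrite /normal_dist_cov sqr_normal_dist_mean.
have /andP[pl _] := @pi_bounds R; have := @pi_gt0 R; move: (pi : R) pl => p pl p0.
have s3 : Num.sqrt 3 ^+ 2 = 3 :> R by rewrite sqr_sqrtr.
have s30 : 0 <= Num.sqrt 3 :> R by rewrite sqrtr_ge0.
move: s3 s30; set w := Num.sqrt 3 => s3 s30.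
have wl : 17 / 10 < w by nra.
rewrite (_ : _ - _ = s ^+ 2 / p * (p / 3 + 2 * w - 4)); last by field; rewrite gt_eqF.
by rewrite mulr_gt0// ?divr_gt0 ?exprn_gt0//; lra.
Qed.

(* u stands for 1 / n. *)
Definition adjacent_fraction (u : R) : R :=
  1 - (1 - u) * (4 * v1 * (1 - u) + 2 * (v0 - 2 * v1) * u) /
      (v0 * (1 - u) + 2 * v1 * (1 - 2 * u)).

Lemma adjacent_fraction0 : adjacent_fraction 0 =
  (pi + 3 - 3 * Num.sqrt 3) / (2 * pi + 3 * Num.sqrt 3 - 9).
Proof.
have v00 := normal_dist_var_gt0; have v10 := normal_dist_cov_gt0.
rewrite /adjacent_fraction !mulr0 !subr0 addr0 !mulr1 mul1r.
have D0 : v0 + 2 * v1 != 0.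
  by rewrite gt_eqF// addr_gt0// mulr_gt0.
rewrite -[X in X - _](divff D0).
rewrite -mulrBl.
have p0 := @pi_gt0 R.
(* The common factor of [v0 - 2 * v1] and [v0 + 2 * v1]; it carries all dependence on [s]. *)
pose q : R := 4 * s ^+ 2 / (3 * pi).
have q0 : q != 0 by rewrite gt_eqF// divr_gt0 ?mulr_gt0 ?exprn_gt0.
have -> : v0 + 2 * v1 - 4 * v1 = q * (pi + 3 - 3 * Num.sqrt 3).
  rewrite /normal_dist_var /normal_dist_cov sqr_normal_dist_mean /q.
  by move: (pi : R) p0 => p p0; field; rewrite gt_eqF.
have -> : v0 + 2 * v1 = q * (2 * pi + 3 * Num.sqrt 3 - 9).
  rewrite /normal_dist_var /normal_dist_cov sqr_normal_dist_mean /q.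
  by move: (pi : R) p0 => p p0; field; rewrite gt_eqF.
by rewrite -mulf_div divff// mul1r.
Qed.

Lemma cvg_adjacent_fraction :
  adjacent_fraction n%:R^-1 @[n --> \oo] -->
    (pi + 3 - 3 * Num.sqrt 3) / (2 * pi + 3 * Num.sqrt 3 - 9).
Proof.
rewrite -adjacent_fraction0.
have u0 : (n%:R : R)^-1 @[n --> \oo] --> (0 : R).
  apply/gtr0_cvgV0; last exact: cvgr_idn.
  by exists 1%N => // n /= n1; rewrite ltr0n.
have du : 1 - (n%:R : R)^-1 @[n --> \oo] --> (1 - 0 : R).
  by apply: cvgB => //; exact: cvg_cst.
have v00 := normal_dist_var_gt0; have v10 := normal_dist_cov_gt0.
apply: cvgB; first exact: cvg_cst.
apply: cvgM; first apply: cvgM => //.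
  by apply: cvgD; apply: cvgM => //; exact: cvg_cst.
apply: cvgV.
  by rewrite !mulr0 !subr0 !mulr1 gt_eqF// addr_gt0// mulr_gt0.
apply: cvgD; apply: cvgM => //; try exact: cvg_cst.
by apply: cvgB; [exact: cvg_cst|apply: cvgM => //; exact: cvg_cst].
Qed.

End limit.

Lemma AdjFracE {R : realType} {d : measure_display} {Omega : measurableType d}
    (P : probability Omega R) (n : nat) (X : 'I_n -> {RV P >-> R})
    (Pi : Omega -> 'S_n) (m s : R) : (2 <= n)%N -> 0 < s ->
  iid_normal X m s -> uniform_permutation P Pi -> permutation_independent X Pi ->
  AdjFrac X Pi = adjacent_fraction s n%:R^-1.
Proof.
case: n X Pi => [//|[//|k]] X Pi _ s0 X_iid Pi_unif indep.
rewrite /AdjFrac (expectation_cond_var s0 X_iid Pi_unif indep).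
rewrite (variance_Tstat s0 X_iid Pi_unif indep)/= /adjacent_fraction.
have := normal_dist_cov_gt0 s0; have := normal_dist_var_gt0 s0.
move: (normal_dist_mean s) (normal_dist_var s) (normal_dist_cov s) => m1 v0 v1 v00 v10.
have c0 : d2^-1 != 0 :> R.
  by rewrite invr_eq0 mulf_neq0// invr_eq0 gt_eqF// sqrtr_gt0 pi_gt0.
move: c0; move: (d2^-1 : R) => c c0.
rewrite !natrM !natrD !natrM.
have -> : k.+2%:R = k%:R + 2 :> R by rewrite -addn2 natrD.
have -> : k.+1%:R = k%:R + 1 :> R by rewrite -addn1 natrD.
have : 0 <= k%:R :> R by [].
move: (k%:R : R) => x x0.
(* With [n = x + 2], this is [n] times the denominator in [adjacent_fraction]; up to a nonzero
   factor it is also the variance of [T]. *)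
have d0 : v0 * (x + 1) + 2 * v1 * x != 0.
  rewrite gt_eqF//; apply: ltr_wpDr; first by rewrite !mulr_ge0// ltW.
  by rewrite mulr_gt0// ltr_wpDl.
have x1 : x + 1 != 0 by rewrite gt_eqF// ltr_wpDl.
have x2 : x + 2 != 0 by rewrite gt_eqF// ltr_wpDl.
field; apply/and4P; split=> //.
  by rewrite (_ : _ + _ = v0 * (x + 1) + 2 * v1 * x)//; ring.
rewrite [X in X != 0](_ : _ = c ^+ 2 * (v0 * (x + 1) + 2 * v1 * x)); last by ring.
by rewrite mulf_neq0// expf_neq0.
Qed.

Theorem mainTheorem4 (R : realType) (mu sigma : R) (sigma_gt0 : 0 < sigma)
    (d : nat -> measure_display) (Omega : forall n : nat, measurableType (d n))
    (P : forall n : nat, probability (Omega n) R)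
    (X : forall n : nat, 'I_n -> {RV (P n) >-> R})
    (Pi : forall n : nat, Omega n -> 'S_n)
    (X_iid : forall n : nat, (2 <= n)%N -> iid_normal (@X n) mu sigma)
    (Pi_unif : forall n : nat, (2 <= n)%N ->
       uniform_permutation (P n) (@Pi n))
    (X_Pi_indep : forall n : nat, (2 <= n)%N ->
       permutation_independent (@X n) (@Pi n)) :
  AdjFrac (@X n) (@Pi n) @[n --> \oo] -->
    (pi + 3 - 3 * Num.sqrt 3) / (2 * pi + 3 * Num.sqrt 3 - 9) /\
  `|(pi + 3 - 3 * Num.sqrt 3) / (2 * pi + 3 * Num.sqrt 3 - 9)
      - 3813 / 10 ^+ 4| <= 2^-1 / 10 ^+ 4 :> R.
Proof.
split; last exact: adjacent_fraction_approx.
apply: cvg_trans (cvg_adjacent_fraction sigma_gt0); apply: near_eq_cvg.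
(* The hypotheses speak only of [n >= 2], so the two sequences are identified from there on. *)
exists 2%N => // n /= n2; apply/esym.
exact: (AdjFracE n2 sigma_gt0 (X_iid n n2) (Pi_unif n n2) (X_Pi_indep n n2)).
Qed.
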